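(* Let $(g,\nabla)$ be a statistical structure on a manifold $M$ such that the connection $\nabla$ is complete and $(\hat\nabla A)(U,U,U,U)\le 0$ for every $U\in\mathcal{U}M$. Then the statistical structure $(g,\nabla)$ is trivial, i.e. $\nabla=\hat\nabla$.
   Context: A statistical structure on a manifold $M$ is a pair $(g,\nabla)$, where $g$ is a positive definite metric tensor field and $\nabla$ is a torsion-free connection on $M$ such that the cubic form $\nabla g$ is symmetric in all its arguments. $\hat\nabla$ denotes the Levi-Civita connection of $g$, $K_XY=K(X,Y)=\nabla_XY-\hat\nabla_XY$ is the difference tensor, and $A$ is the symmetric cubic form $A(X,Y,Z)=g(K(X,Y),Z)$ (so $\nabla g=-2A$). $(\hat\nabla A)(X,Y,Z,W)=(\hat\nabla_XA)(Y,Z,W)$. $\mathcal{U}M$ is the unit sphere bundle of $(M,g)$. The connection $\nabla$ is complete if every maximal $\nabla$-geodesic, parametrized by its affine parameter, is defined on all of $\mathbb{R}$. The structure is trivial if $\nabla=\hat\nabla$ (equivalently $K\equiv0$, equivalently $A\equiv 0$). The metric $g$ is not assumed to be complete. *)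

(* Defs.v *)
From HB Require Import structures.
From mathcomp Require Import all_boot all_order all_algebra.
From mathcomp Require Import all_classical all_reals all_analysis.

Set Implicit Arguments.
Unset Strict Implicit.
Unset Printing Implicit Defensive.

Import Order.TTheory GRing.Theory Num.Theory.
Import numFieldNormedType.Exports.

Local Open Scope classical_set_scope.
Local Open Scope ring_scope.

(* MathComp-Analysis has no manifolds, so this is classical tensor calculus:
   a manifold is a topological space with a smooth atlas, a tangent vector at a
   point is represented in each chart around that point by an element of
   'rV[R]_n, and tensor fields and connections are families of components, one
   per chart of the atlas, subject to the usual transformation laws.  The
   components in a chart are functions of the chart coordinate x; since all
   functions are total, they only carry information for x in the image of the
   chart. *)

Section Smooth.
Variables (R : realType) (n : nat).
Implicit Types (f : 'rV[R]_n -> R) (U : set 'rV[R]_n).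

Fixpoint iter_partial (s : seq 'I_n) f : 'rV[R]_n -> R :=
  if s is i :: s' then 'D_(delta_mx 0 i) (iter_partial s' f) else f.

(* C^oo on the open set U: all iterated partial derivatives exist and are
   continuous *)
Definition smooth_on U f : Prop :=
  forall (s : seq 'I_n) (x : 'rV[R]_n), U x ->
    {for x, continuous (iter_partial s f)} /\
    forall i : 'I_n, derivable (iter_partial s f) x (delta_mx 0 i).

End Smooth.

Section Manifold.
Variables (R : realType) (n : nat).

Record chart (M : topologicalType) := Chart {
  chart_dom : set M;
  chart_cod : set 'rV[R]_n;
  chart_fun : M -> 'rV[R]_n;
  chart_inv : 'rV[R]_n -> M;
  chart_dom_open : open chart_dom;
  chart_cod_open : open chart_cod;
  chart_fun_cod : forall p, chart_dom p -> chart_cod (chart_fun p);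
  chart_inv_dom : forall x, chart_cod x -> chart_dom (chart_inv x);
  chart_funK : forall p, chart_dom p -> chart_inv (chart_fun p) = p;
  chart_invK : forall x, chart_cod x -> chart_fun (chart_inv x) = x;
  chart_fun_continuous : forall p, chart_dom p -> {for p, continuous chart_fun};
  chart_inv_continuous : forall x, chart_cod x -> {for x, continuous chart_inv}
}.

Definition transition (M : topologicalType) (c d : chart M) :
    'rV[R]_n -> 'rV[R]_n :=
  chart_fun d \o chart_inv c.

Definition overlap (M : topologicalType) (c d : chart M) : set 'rV[R]_n :=
  [set x | chart_cod c x /\ chart_dom d (chart_inv c x)].

Record manifold := Manifold {
  carrier :> topologicalType;
  manifold_hausdorff : hausdorff_space carrier;
  manifold_second_countable : @second_countable carrier;
  chart_index : Type;
  atlas : chart_index -> chart carrier;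
  atlas_cover : forall p : carrier, exists i, chart_dom (atlas i) p;
  atlas_smooth : forall (i j : chart_index) (k : 'I_n),
    smooth_on (overlap (atlas i) (atlas j))
      (fun x => transition (atlas i) (atlas j) x 0 k)
}.

End Manifold.

Section StatisticalStructure.
Variables (R : realType) (n : nat) (M : manifold R n).
Implicit Types (i j : chart_index M) (I J : set R) (gamma : R -> M).
Implicit Types (x u v w z : 'rV[R]_n).

Definition bilin (B : 'M[R]_n) u v : R := (u *m B *m v^T) 0 0.

Record metric := Metric {
  metric_mx : chart_index M -> 'rV[R]_n -> 'M[R]_n;
  metric_smooth : forall i (a b : 'I_n),
    smooth_on (chart_cod (atlas i)) (fun x => metric_mx i x a b);
  metric_sym : forall i x, chart_cod (atlas i) x ->
    (metric_mx i x)^T = metric_mx i x;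
  metric_pos : forall i x u, chart_cod (atlas i) x -> u != 0 ->
    0 < bilin (metric_mx i x) u u;
  metric_transition : forall i j x u v, overlap (atlas i) (atlas j) x ->
    let tau := transition (atlas i) (atlas j) in
    bilin (metric_mx i x) u v =
    bilin (metric_mx j (tau x)) ('D_u tau x) ('D_v tau x)
}.

Definition inner (g : metric) i x u v : R := bilin (metric_mx g i x) u v.

(* Gamma(u, v) for the matrices (Gamma^k_ab)_(a,b) *)
Definition christoffel_app (G : 'I_n -> 'M[R]_n) u v : 'rV[R]_n :=
  \row_(k < n) bilin (G k) u v.

(* The covariant derivative with Christoffel symbols Gamma is, in a chart,
   nabla_X Y = 'D_X Y + Gamma(X, Y); the transformation law below says that
   this does not depend on the chart. *)
Record connection := Connection {
  christoffel : chart_index M -> 'rV[R]_n -> 'I_n -> 'M[R]_n;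
  christoffel_smooth : forall i (k a b : 'I_n),
    smooth_on (chart_cod (atlas i)) (fun x => christoffel i x k a b);
  christoffel_transition : forall i j x u v, overlap (atlas i) (atlas j) x ->
    let tau := transition (atlas i) (atlas j) in
    'D_(christoffel_app (christoffel i x) u v) tau x =
    'D_u ('D_v tau) x +
    christoffel_app (christoffel j (tau x)) ('D_u tau x) ('D_v tau x)
}.

(* In chart i, at coordinate x: the value of nabla_U V for the vector fields
   U, V with constant components u, v in that chart *)
Definition conn (nabla : connection) i x u v : 'rV[R]_n :=
  christoffel_app (christoffel nabla i x) u v.

Definition same_connection (nabla nabla' : connection) : Prop :=
  forall i x u v, chart_cod (atlas i) x ->
    conn nabla i x u v = conn nabla' i x u v.

Definition torsion_free (nabla : connection) : Prop :=
  forall i x u v, chart_cod (atlas i) x ->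
    conn nabla i x u v = conn nabla i x v u.

(* (nabla_u g)(v, w) *)
Definition nabla_metric (nabla : connection) (g : metric) i x u v w : R :=
  'D_u (fun y => inner g i y v w) x
  - inner g i x (conn nabla i x u v) w
  - inner g i x v (conn nabla i x u w).

Definition levi_civita (g : metric) (nabla : connection) : Prop :=
  torsion_free nabla /\
  forall i x u v w, chart_cod (atlas i) x -> nabla_metric nabla g i x u v w = 0.

Definition statistical_structure (g : metric) (nabla : connection) : Prop :=
  torsion_free nabla /\
  forall i x u v w, chart_cod (atlas i) x ->
    nabla_metric nabla g i x u v w = nabla_metric nabla g i x v u w /\
    nabla_metric nabla g i x u v w = nabla_metric nabla g i x u w v.

Definition difference_tensor (nabla nabla_hat : connection) i x u v :
    'rV[R]_n :=
  conn nabla i x u v - conn nabla_hat i x u v.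

Definition cubic_form (g : metric) (nabla nabla_hat : connection) i x u v w : R :=
  inner g i x (difference_tensor nabla nabla_hat i x u v) w.

(* (nabla_hat A)(u, v, w, z) = (nabla_hat_u A)(v, w, z) *)
Definition nabla_cubic_form (g : metric) (nabla nabla_hat : connection)
    i x u v w z : R :=
  let A := cubic_form g nabla nabla_hat i in
  'D_u (fun y => A y v w z) x
  - A x (conn nabla_hat i x u v) w z
  - A x v (conn nabla_hat i x u w) z
  - A x v w (conn nabla_hat i x u z).

(* gamma, restricted to the nonempty open interval I, is a nabla-geodesic in
   its affine parameter; its values outside I are irrelevant *)
Definition geodesic (nabla : connection) I gamma : Prop :=
  [/\ I !=set0, open I, is_interval I,
      forall t, I t -> {for t, continuous gamma} &
      forall t i, I t -> chart_dom (atlas i) (gamma t) ->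
        let c := chart_fun (atlas i) \o gamma in
        let dc := derive1 c in
        [/\ derivable c t 1, derivable dc t 1 &
            derive1 dc t + conn nabla i (c t) (dc t) (dc t) = 0]].

Definition maximal_geodesic (nabla : connection) I gamma : Prop :=
  geodesic nabla I gamma /\
  forall J delta, geodesic nabla J delta -> I `<=` J ->
    (forall t, I t -> delta t = gamma t) -> J = I.

Definition complete_connection (nabla : connection) : Prop :=
  forall I gamma, maximal_geodesic nabla I gamma -> I = setT.

End StatisticalStructure.

(* Main.v *)
Require Import Defs.
From HB Require Import structures.
From mathcomp Require Import all_boot all_order all_algebra.
From mathcomp Require Import all_classical all_reals all_analysis.
From mathcomp Require Import ring lra.

Set Implicit Arguments.
Unset Strict Implicit.
Unset Printing Implicit Defensive.

(* [is_derive] is a type class: keep [have] from searching for its instances *)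
Set SsrHave NoTCResolution.

Import Order.TTheory GRing.Theory Num.Theory.
Import numFieldNormedType.Exports.

Local Open Scope classical_set_scope.
Local Open Scope ring_scope.

(** Let [gamma] be a [nabla]-geodesic and [phi = g(gamma', gamma')].  Since
[nabla g = - 2 A], one has [phi' = - 2 A(gamma', gamma', gamma')].  The
[nabla_hat]-acceleration of [gamma] is [- K(gamma', gamma')], so
differentiating once more gives
[phi'' = - 2 (nabla_hat A)(gamma', gamma', gamma', gamma')
         + 6 |K(gamma', gamma')|^2]
([is_derive_speed], [is_derive_cubic]).  The hypothesis on [nabla_hat A], extended
from unit vectors by homogeneity, makes the first term nonnegative, and by
Cauchy-Schwarz [A(gamma', gamma', gamma')^2 <= |K(gamma', gamma')|^2 phi].
Hence [phi'' >= 0] and [2 phi phi'' >= 3 phi'^2]; where [phi] is positive, the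
second inequality says that [phi ^ (- 1 / 2)] is concave.  A function on the
whole line with these properties cannot increase at [0]
([convex_power_derive_le0]).  By completeness every tangent vector [u] is the
velocity at time [0] of a geodesic defined on the whole line, so
[A(u, u, u) >= 0] for all [u]; replacing [u] by [- u] and polarizing gives
[A = 0], that is [K = 0].

The function [phi] is independent of the chart by the transformation law of [g]
([speed2_chart]), so its derivatives can be computed in any chart around the
point considered.

Completeness speaks of maximal geodesics, so the existence of such geodesics
with given initial data has to be established.  Picard iteration
([picard_lipschitz], [ode_local_existence]) solves the geodesic equation in one
chart; the transformation law of Christoffel symbols shows that the solution is
a geodesic in all charts ([geodesic_eq_chart]); Zorn's lemma extends it to a
maximal one ([maximal_geodesic_extension]).  Smoothness is given by iterated partial derivatives, from which
differentiability and Lipschitz bounds follow by the mean value theorem along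
the edges of a box ([box_increment]). *)

(** * Row vectors and curves *)

Section RowVectors.
Context {R : realType}.

Lemma norm_coord_le n (x : 'rV[R]_n) i : `|x 0 i| <= `|x|.
Proof.
rewrite [leRHS]/Num.Def.normr/= mx_normrE.
exact: (le_bigmax _ (fun ij : 'I_1 * 'I_n => `|x ij.1 ij.2|) (ord0, i)).
Qed.

Lemma norm_rV_le n (x : 'rV[R]_n) M :
  0 <= M -> (forall i, `|x 0 i| <= M) -> `|x| <= M.
Proof.
move=> M0 xM; rewrite [leLHS]/Num.Def.normr/= mx_normrE.
by apply: bigmax_le => // -[a b] _ /=; rewrite ord1.
Qed.

Lemma scalar_row_expansion n (f : 'rV[R]_n -> R) u :
  scalar f -> f u = \sum_i u 0 i * f 'e_i.
Proof.
move=> fl; pose fM := GRing.isLinear.Build _ _ _ _ f fl.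
pose F : {linear 'rV[R]_n -> R | *%R} := HB.pack f fM.
rewrite -[f u]/(F u) {1}[u]row_sum_delta linear_sum.
by apply: eq_bigr => i _; rewrite linearZ.
Qed.

Lemma scalarZ_fun n (f : 'rV[R]_n -> R) a u : scalar f -> f (a *: u) = a * f u.
Proof.
move=> fl; have f0 := fl (-1) 0 0; rewrite scaler0 addr0 in f0.
by rewrite -[a *: u]addr0 fl; lra.
Qed.

Lemma scalarD_fun n (f : 'rV[R]_n -> R) u v : scalar f -> f (u + v) = f u + f v.
Proof. by move=> fl; have := fl 1 u v; rewrite scale1r mul1r. Qed.

Lemma scalarN_fun n (f : 'rV[R]_n -> R) u : scalar f -> f (- u) = - f u.
Proof. by move=> fl; rewrite -scaleN1r scalarZ_fun// mulN1r. Qed.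

Lemma scalar0_fun n (f : 'rV[R]_n -> R) : scalar f -> f 0 = 0.
Proof. by move=> fl; rewrite -(scale0r 0) scalarZ_fun// mul0r. Qed.

Lemma is_derive_sumf (V W : normedModType R) n (f : 'I_n -> V -> W) (df : 'I_n -> W) x v :
  (forall i, is_derive x v (f i) (df i)) ->
  is_derive x v (fun y => \sum_i f i y) (\sum_i df i).
Proof.
move=> H; rewrite (_ : (fun _ => _) = \sum_i f i); first exact: is_derive_sum.
by apply/funext => y; rewrite fct_sumE.
Qed.

Lemma is_derive_mul (V : normedModType R) (f g : V -> R) (x v : V) df dg :
  is_derive x v f df -> is_derive x v g dg ->
  is_derive x v (fun y => f y * g y) (df * g x + f x * dg).
Proof.
move=> fd gd; have := is_deriveM fd gd.
by move/is_derive_eq; apply; rewrite /GRing.scale/= addrC (mulrC (g x)).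
Qed.

Lemma is_derive_coord (V : normedModType R) n (c : V -> 'rV[R]_n) x v (w : 'rV[R]_n) i :
  is_derive x v c w -> is_derive x v (fun y => c y 0 i) (w 0 i).
Proof.
move=> [dc cE]; apply: DeriveDef; first by move/derivable_mxP : dc.
by rewrite -cE derive_mx// mxE.
Qed.

Lemma is_derive_rV (V : normedModType R) n (c : V -> 'rV[R]_n) x v (w : 'rV[R]_n) :
  (forall i, is_derive x v (fun y => c y 0 i) (w 0 i)) -> is_derive x v c w.
Proof.
move=> H; have dc : derivable c x v.
  by apply/derivable_mxP => i j; rewrite ord1; have [] := H j.
apply: DeriveDef => //; rewrite derive_mx//; apply/rowP => j; rewrite mxE.
by have [] := H j.
Qed.

Lemma is_derive_along (V W : normedModType R) (f : V -> W) (c : R -> V) (t : R) (w : V) :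
  differentiable f (c t) -> is_derive t 1 c w ->
  is_derive t 1 (fun s => f (c s)) ('D_w f (c t)).
Proof.
move=> df [dc cE].
have cdiff : differentiable c t by apply/derivable1_diffP.
have fcdiff : differentiable (f \o c) t by apply: differentiable_comp.
apply: DeriveDef; first by apply/derivable1_diffP.
by rewrite (@deriveE _ _ _ (f \o c))// diff_comp//= deriveE// -cE deriveE.
Qed.

Lemma is_derive1_continuous (V : normedModType R) (c : R -> V) (t : R) (w : V) :
  is_derive t 1 c w -> {for t, continuous c}.
Proof. by move=> [/derivable1_diffP/differentiable_continuous]. Qed.

(** Differentiating a linear form applied to a moving argument: iterating this over
the slots of a tensor along a curve is the Leibniz rule. *)
Lemma is_derive_linear_slot n (f : R -> 'rV[R]_n -> R)
    (d : 'rV[R]_n -> R) (w : R -> 'rV[R]_n) (w' : 'rV[R]_n) (t : R) :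
  (forall s, scalar (f s)) ->
  (forall u, is_derive t 1 (fun s => f s u) (d u)) ->
  is_derive t 1 w w' ->
  is_derive t 1 (fun s => f s (w s)) (d (w t) + f t w').
Proof.
move=> fl fd wd.
have sumE s u : f s u = \sum_i u 0 i * f s 'e_i by exact: scalar_row_expansion.
have -> : d (w t) = \sum_i w t 0 i * d 'e_i.
  have [_ <-] := fd (w t).
  have <- : (fun s => \sum_i w t 0 i * f s 'e_i) = (fun s => f s (w t)).
    by apply/funext => s; rewrite sumE.
  have H : is_derive t 1 (fun s => \sum_i w t 0 i * f s 'e_i)
      (\sum_i w t 0 i * d 'e_i).
    exact: is_derive_sumf.
  by have [] := H.
have <- : (fun s => \sum_i w s 0 i * f s 'e_i) = (fun s => f s (w s)).
  by apply/funext => s; rewrite sumE.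
rewrite sumE -big_split/=; apply: is_derive_sumf => i.
by rewrite addrC; apply: is_derive_mul => //; exact: is_derive_coord.
Qed.

End RowVectors.

(** * Functions with continuous partial derivatives *)

Section ContinuousPartials.
Context {R : realType}.

Lemma is_derive_line (V W : normedModType R) (f : V -> W) p v (s : R) :
  derivable f (p + s *: v) v ->
  is_derive s 1 (fun r => f (p + r *: v)) ('D_v f (p + s *: v)).
Proof.
have E : (fun h : R => h^-1 *: (f (p + (h *: (1 : R) + s) *: v) - f (p + s *: v))) =
         (fun h : R => h^-1 *: (f (h *: v + (p + s *: v)) - f (p + s *: v))).
  apply/funext => h; congr (_ *: (f _ - _)).
  by rewrite [_%:A]mulr1 scalerDl addrCA.
move=> df; apply: DeriveDef; first by rewrite /derivable /= E.
by rewrite /derive /= E.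
Qed.

Lemma mean_value_01 (g dg : R -> R) :
  (forall s : R, 0 <= s <= 1 -> is_derive s 1 g (dg s)) ->
  exists2 s : R, 0 <= s <= 1 & g 1 - g 0 = dg s.
Proof.
move=> H; have [| |s] := @MVT _ g dg 0 1 ltr01.
- by move=> s; rewrite in_itv/= => /andP[s0 s1]; apply: H; rewrite !ltW.
- apply: derivable_within_continuous => s; rewrite in_itv/= => s01.
  by have [] := H _ s01.
- rewrite in_itv/= => /andP[s0 s1] ->; exists s; first by rewrite !ltW.
  by rewrite subr0 mulr1.
Qed.

(** Walking from [x] to [x + h] parallel to the axes and using the mean value theorem
on each side: it suffices that the partial derivatives are within [e] of [d] on
the box spanned by [x] and [x + h]. *)
Lemma box_increment n (f : 'rV[R]_n -> R) (x h : 'rV[R]_n) (d : 'I_n -> R) e :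
  (forall z : 'rV[R]_n,
     (forall i, exists2 s, 0 <= s <= 1 & z 0 i = x 0 i + s * h 0 i) ->
     forall i, derivable f z 'e_i /\ `|'D_('e_i) f z - d i| <= e) ->
  `|f (x + h) - f x - \sum_i h 0 i * d i| <= e * \sum_i `|h 0 i|.
Proof.
move=> H; pose p k : 'rV[R]_n := x + \row_i (if (i < k)%N then h 0 i else 0).
have -> : f (x + h) - f x = \sum_(i < n) (f (p i.+1) - f (p i)).
  rewrite -(big_mkord xpredT (fun i => f (p i.+1) - f (p i))) telescope_sumr//.
  congr (f _ - f _); apply/rowP => i; rewrite !mxE ?ltn_ord//.
  by rewrite ltn0 addr0.
rewrite -sumrB mulr_sumr (le_trans (ler_norm_sum _ _ _))//.
apply: ler_sum => k _.
have pS : p k.+1 = p k + h 0 k *: 'e_k.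
  apply/rowP => i; rewrite !mxE eqxx/= ltnS -addrA; congr (_ + _).
  have [->|ik] := eqVneq i k; first by rewrite leqnn ltnn mulr1 add0r.
  by rewrite mulr0 addr0 leq_eqVlt; rewrite -val_eqE in ik; rewrite (negbTE ik).
have box (s : R) : 0 <= s <= 1 -> forall i, exists2 r, 0 <= r <= 1 &
    (p k + (s * h 0 k) *: 'e_k) 0 i = x 0 i + r * h 0 i.
  move=> s01 i; rewrite !mxE eqxx/=.
  have [->|ik] := eqVneq i k; first by exists s => //; rewrite ltnn addr0 mulr1.
  rewrite mulr0 addr0; case: ifP => _.
    by exists 1; rewrite ?ler01 ?lexx// mul1r.
  by exists 0; rewrite ?ler01 ?lexx// mul0r.
pose phi r := f (p k + r *: 'e_k).
pose g s := phi (s * h 0 k).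
have gd (s : R) : 0 <= s <= 1 ->
    is_derive s 1 g (h 0 k * 'D_('e_k) f (p k + (s * h 0 k) *: 'e_k)).
  move=> s01; have [fd _] := H _ (box _ s01) k.
  have phid := is_derive_line fd.
  have phidf : differentiable phi (s * h 0 k).
    by apply/derivable1_diffP; have [] := phid.
  have cd : is_derive s 1 (fun r : R => r * h 0 k) (h 0 k).
    have := is_derive_mul (is_derive_id s (1 : R)) (is_derive_cst (h 0 k) s (1 : R)).
    by rewrite mulr0 addr0 mul1r.
  have := @is_derive_along R R R phi (fun r => r * h 0 k) s _ phidf cd.
  move/is_derive_eq; apply.
  rewrite deriveE// -[X in 'd phi _ X]mulr1 [LHS]linearZ/=; congr (_ * _).
  by rewrite -deriveE//; have [] := phid.
have [s s01] := mean_value_01 gd.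
rewrite {1}/g {1}/g /phi mul1r mul0r scale0r addr0 -pS => ->.
by rewrite -mulrBr normrM mulrC ler_wpM2r//; have [] := H _ (box _ s01) k.
Qed.

Lemma sum_coord_le n (h : 'rV[R]_n) : \sum_i `|h 0 i| <= n%:R * `|h|.
Proof.
have -> : n%:R * `|h| = \sum_(i < n) `|h| by rewrite sumr_const card_ord mulr_natl.
by apply: ler_sum => i _; exact: norm_coord_le.
Qed.

Lemma rV_dot_linear n (d : 'I_n -> R) :
  linear (fun h : 'rV[R]_n => \sum_i h 0 i * d i : R).
Proof.
move=> a u v; rewrite scaler_sumr -big_split/=; apply: eq_bigr => i _.
by rewrite !mxE mulrDl -mulrA.
Qed.

(** Continuous differentiability at one point, phrased with partial derivatives. *)
Definition partials_near n (f : 'rV[R]_n -> R) (x : 'rV[R]_n) :=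
  (\forall y \near x, forall i, derivable f y 'e_i) /\
  (forall i, {for x, continuous ('D_('e_i) f)}).

Lemma partials_near_ball n (f : 'rV[R]_n -> R) x e : 0 < e -> partials_near f x ->
  exists2 r, 0 < r & forall y, `|y - x| < r ->
    forall i, derivable f y 'e_i /\ `|'D_('e_i) f y - 'D_('e_i) f x| <= e.
Proof.
move=> e0 [fd fc].
have : \forall y \near x, forall i, derivable f y 'e_i /\
    `|'D_('e_i) f y - 'D_('e_i) f x| <= e.
  near=> y => i; split; first by move: i; near: y.
  rewrite distrC; move: i; near: y; apply: filter_forall => i.
  by have /cvgrPdist_le := fc i; apply.
move=> /nbhs_normP[r/= r0 H]; exists r => // y yx; apply: H => /=.
by rewrite distrC.
Unshelve. all: by end_near. Qed.

Lemma differentiable_of_estimate (V W : normedModType R) (f : V -> W) x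
    (L : {linear V -> W}) : continuous L ->
  (forall e, 0 < e -> \forall h \near 0, `|f (h + x) - f x - L h| <= e * `|h|) ->
  differentiable f x.
Proof.
move=> Lc H; have fL : f \o shift x = cst (f x) + L +o_ 0 id.
  apply/eqaddoP => e e0; near=> h.
  by rewrite /= !fctE/= opprD addrA; near: h; exact: H.
have dE := diff_unique Lc fL.
by apply/diff_locallyP; rewrite dE.
Unshelve. all: by end_near. Qed.

Lemma continuous_partials_differentiable n (f : 'rV[R]_n -> R) x :
  partials_near f x -> differentiable f x.
Proof.
move=> fC.
pose l (h : 'rV[R]_n) : R := \sum_i h 0 i * 'D_('e_i) f x.
pose lM := GRing.isLinear.Build _ _ _ _ l (rV_dot_linear _).
pose L : {linear 'rV[R]_n -> R} := HB.pack l lM.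
have Lc : continuous L.
  apply/linear_bounded_continuous/bounded_funP => r.
  exists (r * \sum_i `|'D_('e_i) f x|) => h hr; rewrite /L/= /l.
  rewrite (le_trans (ler_norm_sum _ _ _))// mulr_sumr ler_sum// => i _.
  by rewrite normrM ler_wpM2r// (le_trans (norm_coord_le _ _)).
apply: (@differentiable_of_estimate _ _ _ _ L) => // e e0.
(* [n.+1] instead of [n] covers dimension [0] *)
have e'0 : 0 < e / n.+1%:R by rewrite divr_gt0.
have [r r0 H] := partials_near_ball e'0 fC.
apply/nbhs_norm0P; exists r => //= h hr.
have B := @box_increment n f x h (fun i => 'D_('e_i) f x) (e / n.+1%:R).
rewrite (addrC h) (le_trans (B _))//.
  move=> z zb i; apply: H.
  apply: le_lt_trans hr; apply: norm_rV_le => // j; rewrite !mxE.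
  have [s /andP[s0 s1] ->] := zb j; rewrite addrAC subrr add0r normrM ger0_norm//.
  by rewrite (le_trans _ (norm_coord_le h j))// ler_piMl.
rewrite (le_trans (ler_wpM2l (ltW e'0) (sum_coord_le h)))//.
rewrite mulrA ler_wpM2r// -mulrA ler_piMr// ?(ltW e0)//.
by rewrite mulrC ler_pdivrMr// mul1r ler_nat.
Qed.

Definition locally_lipschitz_at (V W : normedModType R) (f : V -> W) p :=
  exists r L : R, [/\ 0 < r, 0 <= L & forall y z, `|y - p| < r -> `|z - p| < r ->
    `|f y - f z| <= L * `|y - z|].

Lemma continuous_partials_lipschitz n (f : 'rV[R]_n -> R) x :
  partials_near f x -> locally_lipschitz_at f x.
Proof.
move=> fC; have [r r0 H] := partials_near_ball ltr01 fC.
pose d i := 'D_('e_i) f x.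
exists r, (n%:R + \sum_i `|d i|); split => //.
  by rewrite addr_ge0// sumr_ge0.
move=> z y zr yr.
have := @box_increment n f y (z - y) d 1.
rewrite (addrC y) subrK mul1r => B.
have {}B : `|f z - f y - \sum_i (z - y) 0 i * d i| <= \sum_i `|(z - y) 0 i|.
  apply: B => w wb i; apply: H.
  (* a box whose two extreme corners lie in a ball of the sup norm stays there *)
  apply: (@le_lt_trans _ _ (Num.max `|y - x| `|z - x|)); last by rewrite gt_max yr zr.
  apply: norm_rV_le => [|j]; first by rewrite le_max normr_ge0.
  have [s /andP[s0 s1] wE] := wb j.
  have yj := norm_coord_le (y - x) j; have zj := norm_coord_le (z - x) j.
  have yM : `|y - x| <= Num.max `|y - x| `|z - x| by rewrite le_max lexx.
  have zM : `|z - x| <= Num.max `|y - x| `|z - x| by rewrite le_max lexx orbT.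
  move: yM zM yj zj; set M := Num.max _ _ => yM zM.
  rewrite !mxE wE !mxE => yj zj; have {yM}yj := le_trans yj yM.
  have {zM}zj := le_trans zj zM.
  have -> : y 0 j + s * (z 0 j - y 0 j) - x 0 j =
    (1 - s) * (y 0 j - x 0 j) + s * (z 0 j - x 0 j) by ring.
  rewrite (le_trans (ler_normD _ _))// !normrM (ger0_norm s0).
  rewrite (ger0_norm (_ : 0 <= 1 - s)) ?subr_ge0//.
  have -> : M = (1 - s) * M + s * M by ring.
  by rewrite lerD// ler_wpM2l// subr_ge0.
have S : `|\sum_i (z - y) 0 i * d i| <= (\sum_i `|d i|) * `|z - y|.
  rewrite (le_trans (ler_norm_sum _ _ _))// mulr_suml ler_sum// => i _.
  by rewrite normrM mulrC ler_wpM2l// norm_coord_le.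
rewrite -(subrK (\sum_i (z - y) 0 i * d i) (f z - f y)).
rewrite (le_trans (ler_normD _ _))// mulrDl lerD//.
exact: le_trans B (sum_coord_le _).
Qed.

End ContinuousPartials.

Section Smooth.
Context {R : realType} {n : nat}.
Implicit Types (U : set 'rV[R]_n) (f : 'rV[R]_n -> R).

Lemma smooth_on_partials U f x :
  open U -> smooth_on U f -> U x -> partials_near f x.
Proof.
move=> Uo fU Ux; split; last by move=> i; have [] := fU [:: i] x Ux.
have : \forall y \near x, U y by apply: open_nbhs_nbhs.
by apply: filterS => y Uy i; have [_] := fU [::] y Uy; apply.
Qed.

Lemma smooth_on_differentiable U f x :
  open U -> smooth_on U f -> U x -> differentiable f x.
Proof.
move=> Uo fU Ux; apply: continuous_partials_differentiable.
exact: smooth_on_partials Uo fU Ux.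
Qed.

(** [iter_partial] applies the head of the list last, so the innermost derivative is
the last index of the list. *)
Lemma smooth_on_derive U f i : smooth_on U f -> smooth_on U ('D_('e_i) f).
Proof.
move=> fU s; have -> : iter_partial s ('D_('e_i) f) = iter_partial (rcons s i) f.
  by elim: s => //= j s ->.
exact: fU.
Qed.

End Smooth.

(** * Existence of solutions of ordinary differential equations *)

Section Picard.
Context {R : realType}.

(** The integral is taken from [- b], so that [0] is an interior point of the domain
of integration, and the constant is adjusted afterwards. *)
Lemma antiderivative (f : R -> R) (b : R) : continuous f ->
  exists2 F : R -> R, F 0 = 0 &
    forall t : R, `|t| < b -> is_derive t 1 F (f t).
Proof.
move=> fc; pose mu := @lebesgue_measure R.
pose F0 t := (\int[mu]_(s in [set` `[- b, t]]) f s)%R.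
exists (fun t => F0 t - F0 0); first by rewrite subrr.
move=> t; rewrite ltr_norml => /andP[bt tb].
have fi : mu.-integrable `[- b, b] (EFin \o f).
  apply: continuous_compact_integrable; first exact: segment_compact.
  exact: continuous_subspaceT.
have [F0d F0E] := continuous_FTC1_closed tb fi bt (fc t).
have F0v : 'D_1 F0 t = f t by rewrite -derive1E.
have F0D : is_derive t 1 F0 (f t) by exact: DeriveDef F0d F0v.
have := is_deriveB F0D (is_derive_cst (F0 0) t (1 : R)).
by rewrite subr0.
Qed.

Lemma antiderivative_rV n (f : R -> 'rV[R]_n) (b : R) : continuous f ->
  exists2 F : R -> 'rV[R]_n, F 0 = 0 &
    forall t : R, `|t| < b -> is_derive t 1 F (f t).
Proof.
move=> fc.
have /choice[F FP] : forall i, exists F : R -> R, F 0 = 0 /\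
    forall t : R, `|t| < b -> is_derive t 1 F (f t 0 i).
  move=> i; have [|F F0 FD] := @antiderivative (fun t => f t 0 i) b.
    move=> t; apply: (@continuous_comp _ _ _ f (fun M : 'rV[R]_n => M 0 i)).
      exact: fc.
    exact: coord_continuous.
  by exists F.
exists (fun t => \row_i F i t).
  by apply/rowP => i; rewrite !mxE; have [] := FP i.
move=> t tb; apply: is_derive_rV => i.
rewrite (_ : (fun _ => _) = F i); first by have [_] := FP i; apply.
by apply/funext => s; rewrite mxE.
Qed.

Lemma increment_le n (y dy : R -> 'rV[R]_n) (b M : R) :
  (forall t : R, `|t| < b -> is_derive t 1 y (dy t)) ->
  (forall t, `|t| < b -> `|dy t| <= M) ->
  forall s t, `|s| < b -> `|t| < b -> `|y t - y s| <= M * `|t - s|.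
Proof.
move=> yD dyM s t; wlog st : s t / s <= t => [H sb tb|sb tb].
  have [st|/ltW ts] := leP s t; first exact: H.
  by rewrite distrC (distrC t); apply: H.
have M0 : 0 <= M by apply: le_trans (dyM _ sb).
apply: norm_rV_le => [|i]; first by rewrite mulr_ge0.
have inb r : s <= r <= t -> `|r| < b.
  move=> /andP[sr rt]; move: sb tb; rewrite !ltr_norml => /andP[bs _] /andP[_ tb].
  by rewrite (lt_le_trans bs sr) (le_lt_trans rt tb).
have yiD r : s <= r <= t -> is_derive r 1 (fun r => y r 0 i) (dy r 0 i).
  by move=> /inb/yD ?; exact: is_derive_coord.
have [| |r rst] := @MVT_segment _ (fun r => y r 0 i) (fun r => dy r 0 i) s t st.
- move=> r; rewrite in_itv/= => /andP[sr rt]; apply: yiD.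
  by rewrite !ltW.
- apply: derivable_within_continuous => r; rewrite in_itv/= => /yiD.
  by case.
rewrite !mxE => ->; rewrite normrM ler_wpM2r//.
rewrite in_itv/= in rst.
by rewrite (le_trans (norm_coord_le _ _))// dyM// inb.
Qed.

Definition clamp (h t : R) := Num.max (- h) (Num.min h t).

Lemma clamp_norm h t : 0 <= h -> `|clamp h t| <= h.
Proof.
move=> h0; rewrite /clamp ler_norml le_max lexx/= ge_max ge_min lexx andbT.
by rewrite (le_trans _ h0)// oppr_le0.
Qed.

Lemma clamp_id h t : `|t| <= h -> clamp h t = t.
Proof.
rewrite ler_norml /clamp => /andP[ht th].
by rewrite (min_r th) max_r.
Qed.

Lemma clamp_dist h s t : 0 <= h -> `|clamp h s - clamp h t| <= `|s - t|.
Proof.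
move=> h0; wlog st : s t / s <= t => [H|].
  have [st|/ltW ts] := leP s t; first exact: H.
  by rewrite distrC (distrC s); apply: H.
have -> : `|s - t| = t - s by rewrite distrC ger0_norm ?subr_ge0.
rewrite /clamp ler_norml.
have [a1 a2] : 0 <= Num.min h t - Num.min h s /\ Num.min h t - Num.min h s <= t - s.
  by have [hs|sh] := leP h s; have [ht|th] := leP h t; split; lra.
move: a1 a2; set a := Num.min h s; set b := Num.min h t => a1 a2.
by have [ha|ah] := leP (- h) a; have [hb|bh] := leP (- h) b; apply/andP; split; lra.
Qed.

(** A sequence with geometric increments is squeezed between [u k - 2 C / 2 ^ k],
which increases with [k], and [u k + 2 C / 2 ^ k], which decreases. *)
Lemma geometric_limit (u : nat -> R) C :
  0 <= C -> (forall k, `|u k.+1 - u k| <= C / 2 ^+ k) ->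
  exists l, forall k, `|l - u k| <= 2 * C / 2 ^+ k.
Proof.
move=> C0 uC; pose e k := 2 * C / 2 ^+ k.
have eS k : e k = e k.+1 + C / 2 ^+ k.
  by rewrite /e exprS; field; rewrite expf_neq0//= pnatr_eq0.
have e0 k : 0 <= e k by rewrite /e divr_ge0 ?mulr_ge0// exprn_ge0.
have mono k m : u k - e k <= u (k + m)%N - e (k + m)%N /\
    u (k + m)%N + e (k + m)%N <= u k + e k.
  elim: m => [|m [IH1 IH2]]; first by rewrite addn0.
  rewrite addnS; have := uC (k + m)%N; have := eS (k + m)%N.
  by rewrite ler_norml => E /andP[]; split; lra.
have low k m : u k - e k <= u m + e m.
  have [H1 _] := mono k m; have [_ H2] := mono m k.
  by have := e0 (k + m)%N; rewrite (addnC m) in H2; lra.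
pose S := range (fun k => u k - e k).
have Sub : has_ubound S by exists (u 0%N + e 0%N) => _ [k _ <-].
exists (sup S) => k; rewrite ler_norml.
have := @ub_le_sup _ S Sub (u k - e k) (ex_intro2 _ _ k I erefl).
have : sup S <= u k + e k.
  by apply: ge_sup; [exists (u 0%N - e 0%N), 0%N | move=> _ [m _ <-]].
by rewrite -/(e k) => *; apply/andP; split; lra.
Qed.

Lemma geometric_limit_rV n (u : nat -> 'rV[R]_n) C :
  0 <= C -> (forall k, `|u k.+1 - u k| <= C / 2 ^+ k) ->
  exists l, forall k, `|l - u k| <= 2 * C / 2 ^+ k.
Proof.
move=> C0 uC.
have /choice[l lP] : forall i, exists l, forall k, `|l - u k 0 i| <= 2 * C / 2 ^+ k.
  move=> i; apply: geometric_limit => // k; apply: le_trans (uC k).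
  by have := norm_coord_le (u k.+1 - u k) i; rewrite !mxE.
exists (\row_i l i) => k; apply: norm_rV_le => [|i]; last by rewrite !mxE.
by rewrite divr_ge0 ?mulr_ge0// exprn_ge0.
Qed.

Lemma le_geometric0 (x C : R) : (forall k, x <= C / 2 ^+ k) -> x <= 0.
Proof.
move=> H; rewrite leNgt; apply/negP => x0.
have C0 : 0 < C by have := H 0%N; rewrite expr0 divr1; exact: lt_le_trans.
have := H (Num.bound (C / x)); rewrite leNgt => /negP; apply.
rewrite ltr_pdivrMr ?exprn_gt0// mulrC -ltr_pdivrMr//.
apply: (lt_le_trans (archi_boundP _)); first by rewrite divr_ge0// ltW.
by rewrite -natrX ler_nat ltnW// ltn_expl.
Qed.

Lemma lipschitz_is_continuous (V W : normedModType R) (f : V -> W) B :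
  (forall s t, `|f s - f t| <= B * `|s - t|) -> continuous f.
Proof.
move=> fB t; apply/cvgrPdist_lt => e e0.
apply/nbhs_normP; exists (e / (`|B| + 1)) => /=; first by rewrite divr_gt0// ltr_wpDl.
move=> s /= ts; rewrite (le_lt_trans (fB _ _))//.
rewrite (@le_lt_trans _ _ ((`|B| + 1) * `|t - s|))//.
  by rewrite ler_wpM2r// (le_trans (ler_norm _))// lerDl.
by rewrite mulrC -ltr_pdivlMr// ltr_wpDl.
Qed.

(** The Picard operator [y |-> p + \int_0^t G (y s) ds], frozen outside [[- h, h]], halves
uniform distances between [B]-Lipschitz curves; its iterates converge
uniformly to a fixed point. *)
Lemma picard_lipschitz n (G : 'rV[R]_n -> 'rV[R]_n) p (L B : R) :
  0 <= L -> (forall y z, `|G y - G z| <= L * `|y - z|) ->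
  (forall y, `|G y| <= B) ->
  exists2 y : R -> 'rV[R]_n, y 0 = p /\ (forall s t, `|y s - y t| <= B * `|s - t|) &
    exists2 h : R, 0 < h & forall t : R, `|t| < h -> is_derive t 1 y (G (y t)).
Proof.
move=> L0 GL GB; pose h : R := (2 * (L + 1))^-1.
have h0 : 0 < h by rewrite invr_gt0 mulr_gt0// ltr_wpDl.
(* on an interval of this length the operator contracts by [1 / 2] *)
have Lh : L * h <= 2^-1.
  by rewrite /h invfM mulrCA ler_piMr ?invr_ge0// ler_pdivrMr ?mul1r ?lerDl// ltr_wpDl.
have B0 : 0 <= B by apply: le_trans (GB p).
pose lip (y : R -> 'rV[R]_n) := forall s t, `|y s - y t| <= B * `|s - t|.
have inb t : `|clamp h t| < h + 1.
  by rewrite (le_lt_trans (clamp_norm _ (ltW h0)))// ltrDl.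
pose step (y z : R -> 'rV[R]_n) := exists A : R -> 'rV[R]_n,
  [/\ A 0 = 0, forall t : R, `|t| < h + 1 -> is_derive t 1 A (G (y t)) &
      forall t, z t = p + A (clamp h t)].
have /choice[S SP] : forall y, exists z, lip y -> step y z.
  move=> y; have [ylip|?] := pselect (lip y); last by exists y.
  have Gyc : continuous (G \o y).
    move=> t; apply: continuous_comp; first exact: lipschitz_is_continuous ylip _.
    exact: lipschitz_is_continuous GL _.
  have [A A0 AD] := @antiderivative_rV n (G \o y) (h + 1) Gyc.
  by exists (fun t => p + A (clamp h t)) => _; exists A.
have Slip y : lip y -> lip (S y).
  move=> /SP[A [_ AD zE]] s t; rewrite !zE opprD addrACA subrr add0r.
  have AB := @increment_le _ A (G \o y) (h + 1) B AD (fun t _ => GB _).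
  by rewrite (le_trans (AB _ _ (inb _) (inb _)))// ler_wpM2l// clamp_dist// ltW.
have S0 y : lip y -> S y 0 = p.
  by move=> /SP[A [A0 _ ->]]; rewrite clamp_id ?normr0 ?(ltW h0)// A0 addr0.
have SD y (t : R) : lip y -> `|t| < h -> is_derive t 1 (S y) (G (y t)).
  move=> /SP[A [_ AD zE]] th.
  apply: (@near_eq_is_derive _ _ _ (fun s => p + A s)).
    have : \forall s \near t, `|s| < h.
      exact: (@cvgr_norm_lt _ _ _ _ _ id t) cvg_id _ th.
    by apply: filterS => s sh; rewrite zE clamp_id// ltW.
  have tb : `|t| < h + 1 by rewrite (lt_trans th)// ltrDl.
  have := is_deriveD (is_derive_cst p t (1 : R)) (AD t tb).
  by rewrite add0r.
have Shalf y1 y2 d : lip y1 -> lip y2 -> (forall t, `|y1 t - y2 t| <= d) ->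
    forall t, `|S y1 t - S y2 t| <= d / 2.
  move=> /SP[A1 [A10 A1D z1E]] /SP[A2 [A20 A2D z2E]] yd t.
  have d0 : 0 <= d by apply: le_trans (yd 0).
  have D (s : R) : `|s| < h + 1 -> is_derive s 1 (A1 - A2) (G (y1 s) - G (y2 s)).
    by move=> sb; exact: is_deriveB (A1D s sb) (A2D s sb).
  have DB (s : R) : `|s| < h + 1 -> `|G (y1 s) - G (y2 s)| <= L * d.
    by move=> _; rewrite (le_trans (GL _ _))// ler_wpM2l.
  have zb : `|0 : R| < h + 1 by rewrite normr0 addr_gt0.
  have := increment_le D DB zb (inb t); rewrite !fctE A10 A20 subrr !subr0.
  rewrite z1E z2E opprD addrACA subrr add0r => /le_trans; apply.
  rewrite (le_trans (ler_wpM2l _ (clamp_norm t (ltW h0)))) ?mulr_ge0//.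
  by rewrite mulrAC mulrC ler_wpM2l.
pose u k := iter k S (fun=> p).
have ulip k : lip (u k).
  elim: k => [s t|k IH]; last exact: Slip.
  by rewrite /u/= subrr normr0 mulr_ge0.
have u1 t : `|u 1%N t - u 0%N t| <= B * h.
  have [A [A0 AD zE]] := SP _ (ulip 0%N).
  rewrite {1}/u/= zE addrC addKr -[A _]subr0 -A0.
  have zb : `|0 : R| < h + 1 by rewrite normr0 addr_gt0.
  have := @increment_le _ A _ (h + 1) B AD (fun t _ => GB _) _ _ zb (inb t).
  by move/le_trans; apply; rewrite subr0 ler_wpM2l// clamp_norm// ltW.
have ud k t : `|u k.+1 t - u k t| <= B * h / 2 ^+ k.
  elim: k t => [|k IH] t; first by rewrite expr0 divr1.
  rewrite exprS invfM mulrCA mulrC.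
  exact: (Shalf (u k.+1) (u k) _ (ulip _) (ulip _) IH).
have /choice[y yP] : forall t, exists l, forall k, `|l - u k t| <= 2 * (B * h) / 2 ^+ k.
  by move=> t; apply: geometric_limit_rV => //; rewrite mulr_ge0// ltW.
pose E := 2 * (B * h).
have ylip : lip y.
  move=> s t; rewrite -subr_le0; apply: (@le_geometric0 _ (2 * E)) => k.
  have := yP s k; have := yP t k; have := ulip k s t; rewrite -/E.
  have := ler_distD (u k s) (y s) (y t); have := ler_distD (u k t) (u k s) (y t).
  by rewrite (distrC (u k t) (y t)) -!mulrA; lra.
(* both [S y] and [y] are within a geometric error of the same iterate *)
have yfix : S y = y.
  apply/funext => t; apply/eqP; rewrite -subr_eq0 -normr_le0.
  apply: (@le_geometric0 _ E) => k.
  have H1 := Shalf _ _ _ ylip (ulip k) (fun t => yP t k) t.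
  have H2 := yP t k.+1.
  have := ler_distD (u k.+1 t) (S y t) (y t); rewrite (distrC (u k.+1 t) (y t)).
  by move: H1 H2; rewrite exprS invfM -/E -[u k.+1]/(S (u k)) -!mulrA; lra.
exists y; first by split => //; rewrite -yfix S0.
by exists h => // t th; rewrite -{1}yfix; exact: SD.
Qed.

End Picard.

Section LocallyLipschitz.
Context {R : realType}.

Lemma locally_lipschitz_cst (V W : normedModType R) (w : W) (p : V) :
  locally_lipschitz_at (fun=> w) p.
Proof.
by exists 1, 0; split => // y z _ _; rewrite subrr normr0 mul0r.
Qed.

Lemma locally_lipschitzD (V W : normedModType R) (f g : V -> W) p :
  locally_lipschitz_at f p -> locally_lipschitz_at g p ->
  locally_lipschitz_at (fun y => f y + g y) p.
Proof.
move=> [r [L [r0 L0 fL]]] [r' [L' [r'0 L'0 gL]]].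
exists (Num.min r r'), (L + L'); split; [by rewrite lt_min r0|by rewrite addr_ge0|].
move=> y z; rewrite !lt_min => /andP[yr yr'] /andP[zr zr'].
rewrite opprD addrACA (le_trans (ler_normD _ _))// mulrDl.
by rewrite lerD ?fL ?gL.
Qed.

Lemma locally_lipschitz_scale (V W : normedModType R) (f : V -> R) (w : W) p :
  locally_lipschitz_at f p -> locally_lipschitz_at (fun y => f y *: w) p.
Proof.
move=> [r [L [r0 L0 fL]]]; exists r, (L * `|w|); split => //.
  by rewrite mulr_ge0.
move=> y z yr zr; rewrite -scalerBl normrZ mulrAC ler_wpM2r//.
exact: fL.
Qed.

Lemma locally_lipschitz_bounded (V W : normedModType R) (f : V -> W) p :
  locally_lipschitz_at f p ->
  exists r C : R, [/\ 0 < r, 0 <= C & forall y, `|y - p| < r -> `|f y| <= C].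
Proof.
move=> [r [L [r0 L0 fL]]]; exists r, (L * r + `|f p|); split => //.
  by rewrite addr_ge0// mulr_ge0// ltW.
move=> y yr; rewrite -(subrK (f p) (f y)) (le_trans (ler_normD _ _))// lerD2r.
have pr : `|p - p| < r by rewrite subrr normr0.
by rewrite (le_trans (fL _ _ yr pr))// ler_wpM2l// ltW.
Qed.

Lemma locally_lipschitzM (V : normedModType R) (f g : V -> R) p :
  locally_lipschitz_at f p -> locally_lipschitz_at g p ->
  locally_lipschitz_at (fun y => f y * g y) p.
Proof.
move=> fp gp.
have [a [A [a0 A0 fA]]] := locally_lipschitz_bounded fp.
have [b [B [b0 B0 gB]]] := locally_lipschitz_bounded gp.
have [r [L [r0 L0 fL]]] := fp; have [r' [L' [r'0 L'0 gL]]] := gp.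
exists (Num.min (Num.min a b) (Num.min r r')), (L * B + A * L'); split.
- by rewrite !lt_min a0 b0 r0.
- by rewrite addr_ge0 ?mulr_ge0.
move=> y z; rewrite !lt_min => /andP[/andP[ya yb] /andP[yr yr']].
move=> /andP[/andP[za zb] /andP[zr zr']].
have -> : f y * g y - f z * g z = (f y - f z) * g y + f z * (g y - g z) by ring.
rewrite (le_trans (ler_normD _ _))// !normrM mulrDl lerD//.
  by rewrite mulrAC ler_pM// ?fL ?gB.
by rewrite -mulrA ler_pM// ?fA ?gL.
Qed.

Lemma locally_lipschitz_sum (V W : normedModType R) n (f : 'I_n -> V -> W) p :
  (forall i, locally_lipschitz_at (f i) p) ->
  locally_lipschitz_at (fun y => \sum_i f i y) p.
Proof.
move=> fL; rewrite (_ : (fun _ => _) = \sum_i f i); last first.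
  by apply/funext => y; rewrite fct_sumE.
elim/big_ind : _ => [|g g'|i _]; [exact: locally_lipschitz_cst| |exact: fL].
exact: locally_lipschitzD.
Qed.

Lemma locally_lipschitz_rV (V : normedModType R) n (f : V -> 'rV[R]_n) p :
  (forall i, locally_lipschitz_at (fun y => f y 0 i) p) ->
  locally_lipschitz_at f p.
Proof.
move=> fL; rewrite (_ : f = fun y => \sum_i f y 0 i *: 'e_i); last first.
  by apply/funext => y; exact: row_sum_delta.
by apply: locally_lipschitz_sum => i; exact: locally_lipschitz_scale.
Qed.

Lemma locally_lipschitz_comp1 (U V W : normedModType R) (f : V -> W)
    (l : U -> V) p :
  (forall y z, `|l y - l z| <= `|y - z|) ->
  locally_lipschitz_at f (l p) -> locally_lipschitz_at (fun y => f (l y)) p.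
Proof.
move=> l1 [r [L [r0 L0 fL]]]; exists r, L; split => // y z yr zr.
rewrite (le_trans (fL _ _ _ _)) ?(le_lt_trans (l1 _ _))//.
by rewrite ler_wpM2l.
Qed.

Lemma locally_lipschitz_coord n (p : 'rV[R]_n) i :
  locally_lipschitz_at (fun y : 'rV[R]_n => y 0 i) p.
Proof.
exists 1, 1; split => // y z _ _; rewrite mul1r.
by have := norm_coord_le (y - z) i; rewrite !mxE.
Qed.

(** Retracting space onto a small cube around [p] makes the right-hand side globally
Lipschitz and bounded; the solution stays in the cube for a short time. *)
Lemma ode_local_existence n (F : 'rV[R]_n -> 'rV[R]_n) (p : 'rV[R]_n) :
  locally_lipschitz_at F p ->
  exists2 y : R -> 'rV[R]_n, y 0 = p &
    exists2 h : R, 0 < h & forall t : R, `|t| < h -> is_derive t 1 y (F (y t)).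
Proof.
move=> [r' [L [r'0 L0 FL]]]; pose r := r' / 2.
have r0 : 0 < r by rewrite divr_gt0.
have rr' : r < r' by rewrite ltr_pdivrMr// ltr_pMr// ltr1n.
(* coordinatewise clamping is 1-Lipschitz for the sup norm *)
pose ret (y : 'rV[R]_n) : 'rV[R]_n := \row_i (p 0 i + clamp r (y 0 i - p 0 i)).
have retp y : `|ret y - p| <= r.
  apply: norm_rV_le => [|i]; first exact: ltW.
  by rewrite !mxE addrC addKr clamp_norm// ltW.
have ret1 y z : `|ret y - ret z| <= `|y - z|.
  apply: norm_rV_le => // i; rewrite !mxE opprD addrACA subrr add0r.
  rewrite (le_trans (clamp_dist _ _ (ltW r0)))// opprB addrA addrNK.
  by have := norm_coord_le (y - z) i; rewrite !mxE.
have retE y : `|y - p| <= r -> ret y = y.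
  move=> yr; apply/rowP => i; rewrite mxE clamp_id ?(addrC (p 0 i)) ?subrK//.
  by rewrite (le_trans _ yr)//; have := norm_coord_le (y - p) i; rewrite !mxE.
have retr y : `|ret y - p| < r' by rewrite (le_lt_trans (retp y)).
have GL y z : `|F (ret y) - F (ret z)| <= L * `|y - z|.
  by rewrite (le_trans (FL _ _ (retr _) (retr _)))// ler_wpM2l.
have GB y : `|F (ret y)| <= L * r + `|F p|.
  rewrite -(subrK (F p) (F (ret y))) (le_trans (ler_normD _ _))// lerD2r.
  have pr : `|p - p| < r' by rewrite subrr normr0.
  by rewrite (le_trans (FL _ _ (retr y) pr))// ler_wpM2l.
have [y [y0 yB] [h h0 yD]] := picard_lipschitz p L0 GL GB.
exists y => //; set B := L * r + `|F p| in yB.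
have B0 : 0 <= B by apply: le_trans (GB p).
have B1 : 0 < B + 1 by rewrite ltr_wpDl.
exists (Num.min h (r / (B + 1))); first by rewrite lt_min h0 divr_gt0.
move=> t; rewrite lt_min => /andP[th tr].
rewrite -(retE (y t)); first exact: yD.
rewrite -y0 (le_trans (yB _ _))// subr0 (@le_trans _ _ ((B + 1) * `|t|))//.
  by rewrite ler_wpM2r// lerDl.
by rewrite mulrC -ler_pdivlMr// ltW.
Qed.

Lemma norm_lsubmx n (y : 'rV[R]_(n + n)) : `|lsubmx y| <= `|y|.
Proof. by apply: norm_rV_le => // i; rewrite mxE norm_coord_le. Qed.

(** Reduction to a first-order equation for position and velocity. *)
Lemma second_order_ode n (a : 'rV[R]_n -> 'rV[R]_n -> 'rV[R]_n) x v :
  locally_lipschitz_at (fun y => a (lsubmx y) (rsubmx y)) (row_mx x v) ->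
  exists c w : R -> 'rV[R]_n, [/\ c 0 = x, w 0 = v &
    exists2 h : R, 0 < h & forall t : R, `|t| < h ->
      is_derive t 1 c (w t) /\ is_derive t 1 w (a (c t) (w t))].
Proof.
move=> aL.
pose F (y : 'rV[R]_(n + n)) := row_mx (rsubmx y) (a (lsubmx y) (rsubmx y)).
have FL : locally_lipschitz_at F (row_mx x v).
  apply: locally_lipschitz_rV => i; case: (split_ordP i) => j ->.
    rewrite (_ : (fun _ => _) = fun y : 'rV[R]_(n + n) => y 0 (rshift n j)).
      exact: locally_lipschitz_coord.
    by apply/funext => y; rewrite row_mxEl mxE.
  rewrite (_ : (fun _ => _) = fun y => a (lsubmx y) (rsubmx y) 0 j).
    have [r [L [r0 L0 H]]] := aL; exists r, L; split => // y z yr zr.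
    apply: le_trans (H _ _ yr zr).
    by have := norm_coord_le (a (lsubmx y) (rsubmx y) - a (lsubmx z) (rsubmx z)) j; rewrite !mxE.
  by apply/funext => y; rewrite row_mxEr.
have [y y0 [h h0 yD]] := ode_local_existence FL.
exists (fun t => lsubmx (y t)), (fun t => rsubmx (y t)).
rewrite y0 row_mxKl row_mxKr; split => //; exists h => // t th.
split; apply: is_derive_rV => i.
  rewrite (_ : (fun _ => _) = fun t => y t 0 (lshift n i)); last first.
    by apply/funext => s; rewrite mxE.
  rewrite (_ : rsubmx _ 0 i = F (y t) 0 (lshift n i)); last by rewrite row_mxEl.
  by apply: is_derive_coord; exact: yD.
rewrite (_ : (fun _ => _) = fun t => y t 0 (rshift n i)); last first.
  by apply/funext => s; rewrite mxE.
rewrite (_ : a _ _ 0 i = F (y t) 0 (rshift n i)); last by rewrite row_mxEr.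
by apply: is_derive_coord; exact: yD.
Qed.

End LocallyLipschitz.

(** * Geodesics *)

Section Geodesics.
Context {R : realType} {n : nat} {M : manifold R n}.
Implicit Types (i j : chart_index M) (x u v w : 'rV[R]_n) (nabla : connection M).

Lemma bilinE (B : 'M[R]_n) u v : bilin B u v = \sum_a \sum_b u 0 a * v 0 b * B a b.
Proof.
rewrite /bilin mxE exchange_big/=; apply: eq_bigr => b _.
rewrite !mxE mulr_suml; apply: eq_bigr => a _.
by rewrite mulrAC.
Qed.

Lemma bilin_scalarl (B : 'M[R]_n) v : scalar (fun u => bilin B u v).
Proof. by move=> a u u'; rewrite /bilin !mulmxDl -!scalemxAl !mxE. Qed.

Lemma bilin_scalarr (B : 'M[R]_n) u : scalar (bilin B u).
Proof.
by move=> a v v'; rewrite /bilin linearP/= mulmxDr -scalemxAr !mxE.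
Qed.

Lemma conn_linearl nabla i x v : linear (fun u => conn nabla i x u v).
Proof. by move=> a u u'; apply/rowP => k; rewrite !mxE bilin_scalarl. Qed.

Lemma conn_linearr nabla i x u : linear (conn nabla i x u).
Proof. by move=> a v v'; apply/rowP => k; rewrite !mxE bilin_scalarr. Qed.

Lemma overlap_open i j : open (overlap (atlas i) (atlas j)).
Proof.
rewrite openE => x [xi xj]; rewrite /interior.
near=> y; split; near: y.
- by apply: open_nbhs_nbhs; split => //; exact: chart_cod_open.
- apply: (chart_inv_continuous xi); apply: open_nbhs_nbhs; split => //.
  exact: chart_dom_open.
Unshelve. all: by end_near. Qed.

Local Notation tau i j := (transition (atlas i) (atlas j)).

Lemma transition_differentiable i j x k :
  overlap (atlas i) (atlas j) x -> differentiable (fun y => tau i j y 0 k) x.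
Proof.
move=> xij; apply: smooth_on_differentiable xij; first exact: overlap_open.
exact: atlas_smooth.
Qed.

Lemma transition_derivable i j x u : overlap (atlas i) (atlas j) x ->
  derivable (tau i j) x u.
Proof.
move=> xij; apply/derivable_mxP => a k; rewrite ord1.
by apply: diff_derivable; exact: transition_differentiable.
Qed.

Lemma derive_transition i j x u k : overlap (atlas i) (atlas j) x ->
  ('D_u (tau i j) x) 0 k = 'D_u (fun y => tau i j y 0 k) x.
Proof. by move=> xij; rewrite derive_mx ?mxE//; exact: transition_derivable. Qed.

Lemma derive_scalar (f : 'rV[R]_n -> R) x : differentiable f x ->
  scalar (fun u => 'D_u f x).
Proof. by move=> fd a u v; rewrite !deriveE// linearP. Qed.

Lemma derive_transition_linear i j x : overlap (atlas i) (atlas j) x ->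
  linear (fun u => 'D_u (tau i j) x).
Proof.
move=> xij a u v; apply/rowP => k.
rewrite [RHS]mxE [X in _ = X + _]mxE !(derive_transition _ _ xij).
exact/derive_scalar/transition_differentiable.
Qed.

Lemma is_derive_transition i j (c : R -> 'rV[R]_n) (t : R) w :
  overlap (atlas i) (atlas j) (c t) -> is_derive t 1 c w ->
  is_derive t 1 (fun s => tau i j (c s)) ('D_w (tau i j) (c t)).
Proof.
move=> cij cd; apply: is_derive_rV => k; rewrite derive_transition//.
exact: (is_derive_along (transition_differentiable k cij) cd).
Qed.

Lemma near_curve (T : topologicalType) (U : set T) (c : R -> T) (t : R) :
  open U -> U (c t) -> {for t, continuous c} -> \forall s \near t, U (c s).
Proof. by move=> Uo Uc; apply; apply: open_nbhs_nbhs. Qed.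

(** When [w] is the velocity of [c], this is the second derivative of [tau \o c]; its
two terms are exactly those in the transformation law of Christoffel symbols. *)
Lemma is_derive2_transition i j (c w : R -> 'rV[R]_n) (t : R) w' :
  overlap (atlas i) (atlas j) (c t) -> is_derive t 1 c (w t) ->
  is_derive t 1 w w' ->
  is_derive t 1 (fun s => 'D_(w s) (tau i j) (c s))
    ('D_(w t) ('D_(w t) (tau i j)) (c t) + 'D_w' (tau i j) (c t)).
Proof.
move=> cij cd wd; apply: is_derive_rV => k.
pose T y := tau i j y 0 k; pose f y u := \sum_a u 0 a * 'D_('e_a) T y.
have fl y : scalar (f y) by exact: rV_dot_linear.
have Tf y u : overlap (atlas i) (atlas j) y -> 'D_u T y = f y u.
  move=> yij; rewrite (@scalar_row_expansion _ _ (fun u => 'D_u T y))//.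
  exact/derive_scalar/transition_differentiable.
have fd u : differentiable (f^~ u) (c t).
  rewrite (_ : f^~ u = \sum_a (u 0 a *: 'D_('e_a) T)); last first.
    by apply/funext => y; rewrite fct_sumE.
  apply: differentiable_sum => a; apply: differentiableZ.
  apply: smooth_on_differentiable cij; first exact: overlap_open.
  exact/smooth_on_derive/atlas_smooth.
have fE : \forall y \near c t, overlap (atlas i) (atlas j) y.
  by apply: open_nbhs_nbhs; split => //; exact: overlap_open.
(* a row-vector valued derivative is computed coordinate by coordinate, which needs
   its derivability first *)
have DE u v : ('D_v ('D_u (tau i j)) (c t)) 0 k = 'D_v (f^~ u) (c t).
  have D1 : is_derive (c t) v ('D_u (tau i j))
      (\row_l 'D_v (fun y => 'D_u (tau i j) y 0 l) (c t)).
    apply: is_derive_rV => l; rewrite mxE; apply: derivableP.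
    pose Tl y := tau i j y 0 l.
    apply: (@near_eq_derivable _ _ _ (fun y => \sum_a u 0 a * 'D_('e_a) Tl y)).
      apply: filterS fE => y yij; rewrite derive_transition//.
      rewrite (@scalar_row_expansion _ _ (fun u => 'D_u Tl y))//.
      exact/derive_scalar/transition_differentiable.
    rewrite (_ : (fun _ => _) = \sum_a (u 0 a *: 'D_('e_a) Tl)); last first.
      by apply/funext => y; rewrite fct_sumE.
    apply: diff_derivable; apply: differentiable_sum => a; apply: differentiableZ.
    apply: smooth_on_differentiable cij; first exact: overlap_open.
    exact/smooth_on_derive/atlas_smooth.
  have [_ ->] := D1; rewrite mxE; apply: near_eq_derive.
  by apply: filterS fE => y yij; rewrite derive_transition// -Tf.
have -> : ('D_(w t) ('D_(w t) (tau i j)) (c t) + 'D_w' (tau i j) (c t)) 0 k =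
    'D_(w t) (f^~ (w t)) (c t) + f (c t) w'.
  by rewrite mxE DE (derive_transition _ _ cij) (Tf _ _ cij).
apply: (@near_eq_is_derive _ _ _ (fun s => f (c s) (w s))).
  have : \forall s \near t, overlap (atlas i) (atlas j) (c s).
    apply: near_curve => //; first exact: overlap_open.
    exact: is_derive1_continuous cd.
  by apply: filterS => s sij; rewrite derive_transition// -Tf.
exact: (@is_derive_linear_slot R n (fun s => f (c s))
  (fun u => 'D_(w t) (f^~ u) (c t)) w w' t (fun s => fl (c s))
  (fun u => is_derive_along (fd u) cd) wd).
Qed.

Lemma derive1_is_derive (V : normedModType R) (c : R -> V) (t : R) (w : V) :
  is_derive t 1 c w -> derive1 c t = w.
Proof. by move=> [_ <-]; rewrite derive1E. Qed.

(** Being a geodesic passes from chart [i] to chart [j]: the second derivative of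
[tau \o c] and the transformation law of Christoffel symbols cancel. *)
Lemma geodesic_eq_chart nabla i j (c w : R -> 'rV[R]_n) (t : R) :
  (\forall s \near t, is_derive (s : R) 1 c (w s)) ->
  is_derive t 1 w (- conn nabla i (c t) (w t) (w t)) ->
  overlap (atlas i) (atlas j) (c t) ->
  let d : R -> 'rV[R]_n := fun s => tau i j (c s) in
  [/\ derivable d t 1, derivable (derive1 d) t 1 &
      derive1 (derive1 d) t + conn nabla j (d t) (derive1 d t) (derive1 d t) = 0].
Proof.
move=> cD wD cij d; have cDt := nbhs_singleton cD.
have dD : \forall s \near t, is_derive (s : R) 1 d ('D_(w s) (tau i j) (c s)).
  have sij : \forall s \near t, overlap (atlas i) (atlas j) (c s).
    apply: near_curve => //; first exact: overlap_open.
    exact: is_derive1_continuous cDt.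
  by near=> s; apply: is_derive_transition; near: s.
have dd : derive1 d t = 'D_(w t) (tau i j) (c t).
  exact: derive1_is_derive (nbhs_singleton dD).
have ddD : is_derive t 1 (derive1 d) ('D_(w t) ('D_(w t) (tau i j)) (c t) +
    'D_(- conn nabla i (c t) (w t) (w t)) (tau i j) (c t)).
  apply: (@near_eq_is_derive _ _ _ (fun s => 'D_(w s) (tau i j) (c s))).
    by apply: filterS dD => s /derive1_is_derive ->.
  exact: is_derive2_transition.
split; first by have [] := nbhs_singleton dD.
  by have [] := ddD.
rewrite (derive1_is_derive ddD) dd.
have taul := derive_transition_linear cij.
have -> : 'D_(- conn nabla i (c t) (w t) (w t)) (tau i j) (c t) =
    - 'D_(conn nabla i (c t) (w t) (w t)) (tau i j) (c t).
  have := taul (-1) (conn nabla i (c t) (w t) (w t)) 0.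
  by rewrite derive0 !addr0 !scaleN1r.
by rewrite (christoffel_transition nabla _ _ cij) opprD addrA subrr add0r addNr.
Unshelve. all: by end_near. Qed.

(** The right-hand side of the geodesic equation as a function on phase space, where
position and velocity are the two halves of one row vector. *)
Lemma conn_locally_lipschitz nabla i x u : chart_cod (atlas i) x ->
  locally_lipschitz_at
    (fun y => - conn nabla i (lsubmx y) (rsubmx y) (rsubmx y)) (row_mx x u).
Proof.
move=> xi; apply: locally_lipschitz_rV => k.
rewrite (_ : (fun _ => _) = fun y : 'rV[R]_(n + n) => \sum_a \sum_b
    y 0 (rshift n a) * y 0 (rshift n b) *
    (-1 * christoffel nabla i (lsubmx y) k a b)); last first.
  apply/funext => y; rewrite !mxE bilinE -sumrN; apply: eq_bigr => a _.
  rewrite -sumrN; apply: eq_bigr => b _.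
  by rewrite mulN1r mulrN !mxE.
apply: locally_lipschitz_sum => a; apply: locally_lipschitz_sum => b.
apply: locally_lipschitzM.
  by apply: locally_lipschitzM; exact: locally_lipschitz_coord.
apply: locally_lipschitzM; first exact: locally_lipschitz_cst.
apply: (@locally_lipschitz_comp1 _ _ _ _ (fun z => christoffel nabla i z k a b) lsubmx).
  by move=> y z; rewrite -linearB norm_lsubmx.
rewrite row_mxKl; apply: continuous_partials_lipschitz.
apply: smooth_on_partials xi; first exact: chart_cod_open.
exact: christoffel_smooth.
Qed.

(** The interval is shortened until the solution stays in the image of the chart, so
that it comes from a curve in the manifold. *)
Lemma geodesic_local_existence nabla i x u : chart_cod (atlas i) x ->
  exists I gamma, [/\ geodesic nabla I gamma, I 0, gamma 0 = chart_inv (atlas i) x &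
    derive1 (chart_fun (atlas i) \o gamma) 0 = u].
Proof.
move=> xi; have [c [w [c0 w0 [h h0 cwD]]]] :=
  @second_order_ode R n (fun y z => - conn nabla i y z z) x u
    (conn_locally_lipschitz nabla u xi).
have zh : `|0 : R| < h by rewrite normr0.
have cc : {for (0 : R), continuous c}.
  by have [cD _] := cwD _ zh; exact: is_derive1_continuous cD.
have : \forall t \near (0 : R), chart_cod (atlas i) (c t).
  by apply: near_curve; [exact: chart_cod_open|rewrite c0|exact: cc].
move=> /nbhs_norm0P[h' /= h'0 ci].
pose k := Num.min h h'; have k0 : 0 < k by rewrite lt_min h0.
pose I : set R := [set t | `|t| < k].
have Ih t : I t -> `|t| < h by rewrite /I/= lt_min => /andP[].
have Ii t : I t -> chart_cod (atlas i) (c t).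
  by rewrite /I/= lt_min => /andP[_ ?]; exact: ci.
have Inear t : I t -> \forall s \near t, I s.
  by move=> tI; exact: (@cvgr_norm_lt _ _ _ _ _ id t) cvg_id _ tI.
have I0 : I 0 by rewrite /I/= normr0.
pose gamma := chart_inv (atlas i) \o c.
have cont t : I t -> {for t, continuous c}.
  by move=> /Ih/cwD[cD _]; exact: is_derive1_continuous cD.
exists I, gamma; split => //=.
- split.
  + by exists 0.
  + by rewrite openE => t tI; exact: Inear.
  + move=> a b Ia Ib z /andP[az zb]; move: Ia Ib; rewrite /I/= !ltr_norml.
    by move=> /andP[ka _] /andP[_ bk]; rewrite (lt_le_trans ka az) (le_lt_trans zb bk).
  + move=> t tI; apply: continuous_comp; first exact: cont.
    by apply: chart_inv_continuous; exact: Ii.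
  + move=> t j tI tj; have [cD wD] := cwD _ (Ih _ tI).
    apply: (geodesic_eq_chart _ wD); last by split => //; exact: Ii.
    by apply: filterS (Inear _ tI) => s /Ih/cwD[].
- by rewrite /gamma/= c0.
- rewrite -w0; have [cD _] := cwD _ zh.
  apply: derive1_is_derive; apply: near_eq_is_derive cD.
  by apply: filterS (Inear _ I0) => s /Ii si; rewrite /gamma/= chart_invK.
Qed.

(** Continuity and the geodesic equation at [t] depend only on germs of [gamma] at [t],
through its first two derivatives. *)
Lemma geodesic_is_local nabla (J : set R) (gamma : R -> M) :
  J !=set0 -> is_interval J ->
  (forall t, J t -> exists I delta, [/\ geodesic nabla I delta, I t, I `<=` J &
     forall s, I s -> gamma s = delta s]) ->
  geodesic nabla J gamma.
Proof.
move=> J0 Ji H; split => //.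
- rewrite openE => t /H[I [delta [[_ Io _ _ _] It IJ _]]].
  by apply: filterS IJ _; exact: open_nbhs_nbhs.
- move=> t /H[I [delta [[_ Io _ dc _] It IJ gE]]].
  suff : gamma @ t --> gamma t by [].
  rewrite gE//; apply: cvg_trans (dc t It).
  apply: near_eq_cvg; have : \forall s \near t, I s by exact: open_nbhs_nbhs.
  by apply: filterS => s /gE.
- move=> t j /H[I [delta [[_ Io _ _ dg] It IJ gE]]].
  have It' : \forall s \near t, I s by exact: open_nbhs_nbhs.
  rewrite gE// => tj; have [dd ddd dE] := dg t j It tj.
  have cE : \forall s \near t, (chart_fun (atlas j) \o delta) s =
      (chart_fun (atlas j) \o gamma) s.
    by apply: filterS It' => s sI /=; rewrite gE.
  have dcE : \forall s \near t, derive1 (chart_fun (atlas j) \o delta) s =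
      derive1 (chart_fun (atlas j) \o gamma) s.
    have : \forall s \near t, \forall r \near s, I r.
      by apply: filterS It' => s sI; exact: open_nbhs_nbhs.
    apply: filterS => s sI; rewrite !derive1E; apply: near_eq_derive.
    by apply: filterS sI => r rI /=; rewrite gE.
  have ddcE : derive1 (derive1 (chart_fun (atlas j) \o gamma)) t =
      derive1 (derive1 (chart_fun (atlas j) \o delta)) t.
    rewrite [LHS]derive1E [RHS]derive1E; apply: near_eq_derive.
    by apply: filterS dcE => s ->.
  have e0 := nbhs_singleton cE; have e1 := nbhs_singleton dcE.
  split.
  + exact: near_eq_derivable cE dd.
  + exact: near_eq_derivable dcE ddd.
  + by rewrite ddcE -e1 -e0.
Qed.

(** Zorn's lemma on the extensions of [gamma]: the union of a chain of geodesics is a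
geodesic, since being one is a local condition. *)
Lemma maximal_geodesic_extension nabla I gamma : geodesic nabla I gamma ->
  exists J delta, [/\ maximal_geodesic nabla J delta, I `<=` J &
    forall t, I t -> delta t = gamma t].
Proof.
move=> gI.
pose ext (p q : set R * (R -> M)) :=
  p.1 `<=` q.1 /\ forall t, p.1 t -> q.2 t = p.2 t.
have ext_refl p : ext p p by split.
have ext_trans p q r : ext p q -> ext q r -> ext p r.
  move=> [pq pqE] [qr qrE]; split => [t /pq/qr//|t pt].
  by rewrite qrE ?pqE//; exact: pq.
pose T := {p : set R * (R -> M) | geodesic nabla p.1 p.2 /\ ext (I, gamma) p}.
pose t0 : T := exist _ (I, gamma) (conj gI (ext_refl _)).
pose rel (p q : T) := `[< ext (sval p) (sval q) >].
have [|||] := @ZL_preorder T t0 rel.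
- by move=> p; apply/asboolP; exact: ext_refl.
- by move=> q p r /asboolP pq /asboolP qr; apply/asboolP; exact: ext_trans qr.
- move=> A Atot.
  have [[p0 Ap0]|A0] := pselect (exists p, A p); last first.
    by exists t0 => p Ap; case: A0; exists p.
  have /choice[delta deltaP] : forall t, exists y,
      forall p, A p -> (sval p).1 t -> y = (sval p).2 t.
    move=> t; have [[p [Ap pt]]|N] := pselect (exists p, A p /\ (sval p).1 t).
      exists ((sval p).2 t) => q Aq qt.
      by have [/asboolP[_ E]|/asboolP[_ E]] := Atot _ _ Ap Aq; [rewrite E|rewrite E].
    by exists (gamma t) => p Ap pt; case: N; exists p.
  pose J : set R := [set t | exists2 p, A p & (sval p).1 t].
  have gJ : geodesic nabla J delta.
    apply: geodesic_is_local.
    + have [[[t pt] _ _ _ _] _] := svalP p0.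
      by exists t, p0.
    + move=> a b [p Ap pa] [q Aq qb] z azb.
      have [/asboolP[S _]|/asboolP[S _]] := Atot _ _ Ap Aq.
        exists q => //; have [[_ _ qi _ _] _] := svalP q.
        by apply: (qi a b) => //; exact: S.
      exists p => //; have [[_ _ pi _ _] _] := svalP p.
      by apply: (pi a b) => //; exact: S.
    + move=> t [p Ap pt]; exists (sval p).1, (sval p).2; split => //.
      * by have [] := svalP p.
      * by move=> s ps; exists p.
      * by move=> s ps; exact: deltaP.
  have pJ p : A p -> ext (sval p) (J, delta).
    move=> Ap; split => [t pt|t pt /=]; first by exists p.
    exact: deltaP.
  have IJ : ext (I, gamma) (J, delta).
    by have [_ Ip] := svalP p0; exact: ext_trans Ip (pJ _ Ap0).
  exists (exist _ (J, delta) (conj gJ IJ)) => p Ap; apply/asboolP.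
  exact: pJ.
move=> [[J delta] [/= gJ IJ]] Jmax; have [IJs IJE] := IJ.
exists J, delta; split => //; split => // K eps gK JK epsE.
have JKe : ext (J, delta) (K, eps) by split.
have /asboolP[KJ _] := Jmax (exist _ (K, eps) (conj gK (ext_trans _ _ _ IJ JKe)))
  (asboolT JKe).
by apply/seteqP.
Qed.

Lemma complete_geodesic_existence nabla i x u :
  complete_connection nabla -> chart_cod (atlas i) x ->
  exists gamma, [/\ geodesic nabla setT gamma, gamma 0 = chart_inv (atlas i) x &
    derive1 (chart_fun (atlas i) \o gamma) 0 = u].
Proof.
move=> complete xi.
have [I [gamma [gI I0 g0 dg0]]] := geodesic_local_existence nabla u xi.
have [J [delta [Jmax IJ deltaE]]] := maximal_geodesic_extension gI.
have JT := complete _ _ Jmax; exists delta; split.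
- by rewrite -JT; have [] := Jmax.
- by rewrite deltaE.
- rewrite -dg0 !derive1E; apply: near_eq_derive.
  have [_ Io _ _ _] := gI.
  have : \forall s \near (0 : R), I s by exact: open_nbhs_nbhs.
  by apply: filterS => s /deltaE /= ->.
Qed.

End Geodesics.

(** * A differential inequality on the whole line *)

(** If [phi' 0 > 0], then [phi'] stays positive to the right of [0], and the Newton
quotient [phi / phi'] decreases there at a rate of at least [1 / 2], hence
becomes negative in finite time. *)
Lemma convex_power_derive_le0 (R : realType) (phi phi' phi'' : R -> R) :
  (forall t : R, is_derive t 1 phi (phi' t)) ->
  (forall t : R, is_derive t 1 phi' (phi'' t)) ->
  (forall t, 0 <= phi t) -> (forall t, 0 <= phi'' t) ->
  (forall t, 3 * phi' t ^+ 2 <= 2 * (phi t * phi'' t)) ->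
  phi' 0 <= 0.
Proof.
move=> D1 D2 phi0 phi''0 H; rewrite leNgt; apply/negP => p0.
have phi'_gt0 t : 0 <= t -> 0 < phi' t.
  move=> t0; have [|c _] := @MVT_segment _ phi' phi'' 0 t t0.
    by apply: derivable_within_continuous => s _; have [] := D2 s.
  have := mulr_ge0 (phi''0 c) t0; rewrite subr0; lra.
pose q t := phi t * (phi' t)^-1.
pose q' t := phi' t * (phi' t)^-1 + phi t * (- (phi' t) ^- 2 * phi'' t).
have qD (t : R) : 0 <= t -> is_derive t 1 q (q' t).
  move=> t0; apply: is_derive_mul => //.
  have n0 : phi' t != 0 by rewrite gt_eqF// phi'_gt0.
  have [d e] := D2 t; apply: DeriveDef; first exact: derivableV.
  by rewrite deriveV// e.
have q'_le t : 0 <= t -> q' t <= - 2^-1.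
  move=> t0; have p := phi'_gt0 t t0.
  have -> : q' t = 1 - phi t * phi'' t / phi' t ^+ 2.
    by rewrite /q' divff ?gt_eqF// mulNr mulrN mulrCA mulrC -mulrA (mulrC (phi'' t)).
  have : 3 / 2 <= phi t * phi'' t / phi' t ^+ 2.
    by rewrite ler_pdivlMr ?exprn_gt0//; have := H t; lra.
  lra.
have q0 t : 0 <= t -> 0 <= q t.
  by move=> t0; rewrite /q divr_ge0// ltW// phi'_gt0.
(* at time [2 q(0)] the bound on [q] reaches [0]; one more unit makes it negative *)
have T0 : 0 <= 2 * q 0 + 1 by rewrite addr_ge0// mulr_ge0// q0.
have [| |c] := @MVT_segment _ q q' 0 (2 * q 0 + 1) T0.
- by move=> t; rewrite in_itv/= => /andP[t0 _]; apply: qD; exact: ltW.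
- apply: derivable_within_continuous => t; rewrite in_itv/= => /andP[t0 _].
  by have [] := qD t t0.
rewrite in_itv/= subr0 => /andP[c0 _] E.
have := ler_wpM2r T0 (q'_le c c0); have := q0 _ T0; rewrite -E; lra.
Qed.

(** * The cubic form along geodesics *)

Section CubicForm.
Context {R : realType} {n : nat} {M : manifold R n}.
Variables (g : metric M) (nabla nabla_hat : connection M).
Hypotheses (stat : statistical_structure g nabla) (lc : levi_civita g nabla_hat).
Implicit Types (i j : chart_index M) (x u v w z : 'rV[R]_n).

Local Notation K := (difference_tensor nabla nabla_hat).
Local Notation A := (cubic_form g nabla nabla_hat).
Local Notation dA := (nabla_cubic_form g nabla nabla_hat).

Lemma inner_sym i x u v : chart_cod (atlas i) x -> inner g i x u v = inner g i x v u.
Proof.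
move=> xi; rewrite /inner /bilin.
have <- : (v *m metric_mx g i x *m u^T)^T = u *m metric_mx g i x *m v^T.
  by rewrite !trmx_mul trmxK Defs.metric_sym// mulmxA.
by rewrite mxE.
Qed.

Lemma inner_scalarl i x v : scalar (fun u => inner g i x u v).
Proof. exact: bilin_scalarl. Qed.

Lemma inner_scalarr i x u : scalar (inner g i x u).
Proof. exact: bilin_scalarr. Qed.

Lemma inner_ge0 i x u : chart_cod (atlas i) x -> 0 <= inner g i x u u.
Proof.
move=> xi; have [->|u0] := eqVneq u 0; last by rewrite ltW// metric_pos.
by rewrite (scalar0_fun (@inner_scalarr i x 0)).
Qed.

Lemma inner_eq0 i x u : chart_cod (atlas i) x -> inner g i x u u = 0 -> u = 0.
Proof.
move=> xi uu; apply/eqP; apply: contraTT isT => u0.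
by have := metric_pos g xi u0; rewrite -/(inner g i x u u) uu ltxx.
Qed.

Lemma cauchy_schwarz_metric i x u v : chart_cod (atlas i) x ->
  inner g i x u v ^+ 2 <= inner g i x u u * inner g i x v v.
Proof.
move=> xi; have [->|v0] := eqVneq v 0.
  rewrite (scalar0_fun (@inner_scalarr i x u)) expr0n.
  by rewrite mulr_ge0// inner_ge0.
have p := metric_pos g xi v0; rewrite -/(inner g i x v v) in p.
(* [u] minus its projection on [v], scaled by [|v|^2] to avoid division *)
have := inner_ge0 (inner g i x v v *: u + (- inner g i x u v) *: v) xi.
have E a b : inner g i x (a *: u + b *: v) (a *: u + b *: v) =
    a ^+ 2 * inner g i x u u + 2 * a * b * inner g i x u v + b ^+ 2 * inner g i x v v.
  rewrite inner_scalarl (scalarZ_fun _ _ (@inner_scalarl i x _)) !inner_scalarr.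
  rewrite !(scalarZ_fun _ _ (@inner_scalarr i x _)) (inner_sym v u xi).
  ring.
rewrite E => F.
have : 0 <= inner g i x v v * (inner g i x u u * inner g i x v v - inner g i x u v ^+ 2).
  by apply: le_trans F _; rewrite le_eqVlt; apply/orP; left; apply/eqP; ring.
by rewrite pmulr_rge0// subr_ge0.
Qed.

Lemma diff_tensor_linearl i x v : linear (fun u => K i x u v).
Proof.
move=> a u u'; rewrite /difference_tensor !conn_linearl scalerBr opprD.
by rewrite addrACA.
Qed.

Lemma diff_tensor_linearr i x u : linear (K i x u).
Proof.
move=> a v v'; rewrite /difference_tensor !conn_linearr scalerBr opprD.
by rewrite addrACA.
Qed.

Lemma diff_tensor_sym i x u v : chart_cod (atlas i) x -> K i x u v = K i x v u.
Proof.
by move=> xi; have [T _] := stat; have [T' _] := lc; rewrite /difference_tensor T// T'.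
Qed.

Lemma cubic_scalar1 i x v w : scalar (fun u => A i x u v w).
Proof.
move=> a u u'; rewrite /cubic_form (diff_tensor_linearl _ _ v a u u').
exact: inner_scalarl.
Qed.

Lemma cubic_scalar2 i x u w : scalar (fun v => A i x u v w).
Proof.
move=> a v v'; rewrite /cubic_form (diff_tensor_linearr _ _ u a v v').
exact: inner_scalarl.
Qed.

Lemma cubic_scalar3 i x u v : scalar (A i x u v).
Proof. by move=> a w w'; exact: inner_scalarr. Qed.

(** The cubic form inherits the symmetries of both [K] (no torsion) and [nabla g],
whose value on [u, v, w] is [- A u v w - A u w v] because [nabla_hat g = 0]. *)
Lemma nabla_metric_cubic i x u v w : chart_cod (atlas i) x ->
  nabla_metric nabla g i x u v w = - A i x u v w - A i x u w v.
Proof.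
move=> xi; have [_ lc0] := lc; have := lc0 i x u v w xi.
rewrite /nabla_metric /cubic_form /difference_tensor => E.
have L a b c : inner g i x (a - b) c = inner g i x a c - inner g i x b c.
  by rewrite (scalarD_fun _ _ (@inner_scalarl i x c)) (scalarN_fun _ (@inner_scalarl i x c)).
rewrite !L -(inner_sym v (conn nabla i x u w))// -(inner_sym v (conn nabla_hat i x u w))//.
lra.
Qed.

Lemma cubic_sym12 i x u v w : chart_cod (atlas i) x -> A i x u v w = A i x v u w.
Proof. by move=> xi; rewrite /cubic_form diff_tensor_sym. Qed.

Lemma cubic_sym13 i x u v w : chart_cod (atlas i) x -> A i x u v w = A i x w v u.
Proof.
move=> xi; have [_ S] := stat; have [E _] := S i x u w v xi.
move: E; rewrite !nabla_metric_cubic// (cubic_sym12 w u v)//; lra.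
Qed.

Lemma cubic_sym23 i x u v w : chart_cod (atlas i) x -> A i x u v w = A i x u w v.
Proof.
by move=> xi; rewrite cubic_sym12// (cubic_sym13 v)// (cubic_sym12 w).
Qed.

Lemma bilin_differentiable (B : 'rV[R]_n -> 'M[R]_n) (U V : 'rV[R]_n -> 'rV[R]_n) x :
  (forall a b, differentiable (fun y => B y a b) x) ->
  (forall a, differentiable (fun y => U y 0 a) x) ->
  (forall a, differentiable (fun y => V y 0 a) x) ->
  differentiable (fun y => bilin (B y) (U y) (V y)) x.
Proof.
move=> Bd Ud Vd.
rewrite (_ : (fun _ => _) = \sum_a \sum_b
   ((fun y => U y 0 a) * (fun y => V y 0 b) * (fun y => B y a b))); last first.
  by apply/funext => y; rewrite bilinE !fct_sumE; apply: eq_bigr => a _; rewrite fct_sumE.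
apply: differentiable_sum => a; apply: differentiable_sum => b.
by apply: differentiableM => //; exact: differentiableM.
Qed.

Lemma inner_differentiable i x u v : chart_cod (atlas i) x ->
  differentiable (fun y => inner g i y u v) x.
Proof.
move=> xi; apply: bilin_differentiable => [a b|a|a]; try exact: differentiable_cst.
apply: smooth_on_differentiable xi; first exact: chart_cod_open.
exact: metric_smooth.
Qed.

Lemma conn_differentiable (D : connection M) i x u v k : chart_cod (atlas i) x ->
  differentiable (fun y => conn D i y u v 0 k) x.
Proof.
move=> xi; rewrite (_ : (fun _ => _) = fun y => bilin (christoffel D i y k) u v).
  apply: bilin_differentiable => [a b|a|a]; try exact: differentiable_cst.
  apply: smooth_on_differentiable xi; first exact: chart_cod_open.
  exact: christoffel_smooth.
by apply/funext => y; rewrite mxE.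
Qed.

Lemma cubic_differentiable i x u v w : chart_cod (atlas i) x ->
  differentiable (fun y => A i y u v w) x.
Proof.
move=> xi; apply: bilin_differentiable => [a b|a|a]; last exact: differentiable_cst.
  apply: smooth_on_differentiable xi; first exact: chart_cod_open.
  exact: metric_smooth.
rewrite (_ : (fun _ => _) =
  (fun y => conn nabla i y u v 0 a) - (fun y => conn nabla_hat i y u v 0 a)).
  by apply: differentiableB; exact: conn_differentiable.
by apply/funext => y; rewrite !fctE /difference_tensor mxE [X in _ + X]mxE.
Qed.

Section AlongCurve.
Variables (i : chart_index M) (c w : R -> 'rV[R]_n) (t : R).
Hypotheses (ci : chart_cod (atlas i) (c t)) (cD : is_derive t 1 c (w t)).
Hypothesis wD : is_derive t 1 w (- conn nabla i (c t) (w t) (w t)).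

(** The derivative of the squared speed is [(nabla_w g)(w, w)]: the acceleration of a
geodesic supplies the two connection terms of the covariant derivative. *)
Lemma is_derive_speed :
  is_derive t 1 (fun s => inner g i (c s) (w s) (w s))
    (- 2 * A i (c t) (w t) (w t) (w t)).
Proof.
have D0 u v : is_derive t 1 (fun s => inner g i (c s) u v)
    ('D_(w t) (fun y => inner g i y u v) (c t)).
  exact: (is_derive_along (inner_differentiable u v ci) cD).
have D1 v := is_derive_linear_slot
  (fun s => @inner_scalarl i (c s) v) (D0^~ v) wD.
have D2 := is_derive_linear_slot
  (fun s => @inner_scalarr i (c s) (w s)) D1 wD.
apply: is_derive_eq D2 _.
have := nabla_metric_cubic (w t) (w t) (w t) ci; rewrite /nabla_metric.
set k := conn _ _ _ _ _.
rewrite (scalarN_fun _ (@inner_scalarl i (c t) _)).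
rewrite (scalarN_fun _ (@inner_scalarr i (c t) _)); lra.
Qed.

(** Differentiating [A] along the geodesic: the acceleration [- nabla_w w] differs from
[- nabla_hat_w w] by [- K w w], and each of the three slots turns this into
[- |K w w|^2] by the symmetry of [A]. *)
Lemma is_derive_cubic :
  is_derive t 1 (fun s => A i (c s) (w s) (w s) (w s))
    (dA i (c t) (w t) (w t) (w t) (w t) -
     3 * inner g i (c t) (K i (c t) (w t) (w t)) (K i (c t) (w t) (w t))).
Proof.
have D0 u v z : is_derive t 1 (fun s => A i (c s) u v z)
    ('D_(w t) (fun y => A i y u v z) (c t)).
  exact: (is_derive_along (cubic_differentiable u v z ci) cD).
have D1 v z := is_derive_linear_slot
  (fun s => @cubic_scalar1 i (c s) v z) (fun u => D0 u v z) wD.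
have D2 z := is_derive_linear_slot
  (fun s => @cubic_scalar2 i (c s) (w s) z) (D1^~ z) wD.
have D3 := is_derive_linear_slot
  (fun s => @cubic_scalar3 i (c s) (w s) (w s)) D2 wD.
apply: is_derive_eq D3 _.
rewrite /nabla_cubic_form; set x := c t; set u := w t.
set k := K i x u u.
have -> : - conn nabla i x u u = - (conn nabla_hat i x u u + k).
  by rewrite /k /difference_tensor addrC subrK.
rewrite (scalarN_fun _ (@cubic_scalar1 i x u u)) (scalarD_fun _ _ (@cubic_scalar1 i x u u)).
rewrite (scalarN_fun _ (@cubic_scalar2 i x u u)) (scalarD_fun _ _ (@cubic_scalar2 i x u u)).
rewrite (scalarN_fun _ (@cubic_scalar3 i x u u)) (scalarD_fun _ _ (@cubic_scalar3 i x u u)).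
have E3 : A i x u u k = inner g i x k k by [].
have E2 : A i x u k u = inner g i x k k by rewrite cubic_sym23.
have E1 : A i x k u u = inner g i x k k by rewrite cubic_sym12.
rewrite E1 E2 E3; lra.
Qed.

End AlongCurve.

(** Allowing [a = 0] also gives the value at the zero vector. *)
Lemma nabla_cubic_homogeneous i x u a : chart_cod (atlas i) x ->
  dA i x (a *: u) (a *: u) (a *: u) (a *: u) = a ^+ 4 * dA i x u u u u.
Proof.
move=> xi.
have Z1 y b v w z : A i y (b *: v) w z = b * A i y v w z.
  exact: (scalarZ_fun _ _ (@cubic_scalar1 i y w z)).
have Z2 y b v w z : A i y v (b *: w) z = b * A i y v w z.
  exact: (scalarZ_fun _ _ (@cubic_scalar2 i y v z)).
have Z3 y b v w z : A i y v w (b *: z) = b * A i y v w z.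
  exact: (scalarZ_fun _ _ (@cubic_scalar3 i y v w)).
have ZC : conn nabla_hat i x (a *: u) (a *: u) = a ^+ 2 *: conn nabla_hat i x u u.
  apply/rowP => k; rewrite !mxE.
  rewrite (scalarZ_fun _ _ (@bilin_scalarl _ _ (christoffel nabla_hat i x k) _)).
  by rewrite (scalarZ_fun _ _ (@bilin_scalarr _ _ (christoffel nabla_hat i x k) _)) mulrA.
rewrite /nabla_cubic_form !(ZC, Z1, Z2, Z3).
have -> : 'D_(a *: u) (fun y => A i y (a *: u) (a *: u) (a *: u)) x =
    a ^+ 4 * 'D_u (fun y => A i y u u u) x.
  rewrite (_ : (fun _ => _) = a ^+ 3 *: (fun y => A i y u u u)); last first.
    by apply/funext => y; rewrite Z1 Z2 Z3 !fctE /GRing.scale/=; ring.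
  have d := cubic_differentiable u u u xi.
  rewrite (scalarZ_fun _ _ (derive_scalar (differentiableZ _ d))).
  rewrite deriveZ; last exact: diff_derivable.
  by rewrite /GRing.scale/=; ring.
ring.
Qed.

Lemma nabla_cubic_le0 i x u : chart_cod (atlas i) x ->
  (forall v, inner g i x v v = 1 -> dA i x v v v v <= 0) ->
  dA i x u u u u <= 0.
Proof.
move=> xi H; have [->|u0] := eqVneq u 0.
  by have := nabla_cubic_homogeneous 0 0 xi; rewrite scaler0 expr0n mul0r => ->.
have p := metric_pos g xi u0; rewrite -/(inner g i x u u) in p.
pose r := Num.sqrt (inner g i x u u).
have r0 : 0 < r by rewrite sqrtr_gt0.
have -> : u = r *: (r^-1 *: u) by rewrite scalerA divff ?scale1r// gt_eqF.
rewrite nabla_cubic_homogeneous// pmulr_rle0 ?exprn_gt0//; apply: H.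
rewrite (scalarZ_fun _ _ (@inner_scalarl i x _)).
rewrite (scalarZ_fun _ _ (@inner_scalarr i x _)) mulrA.
by rewrite -invfM -expr2 sqr_sqrtr ?(ltW p)// mulVf// gt_eqF.
Qed.

(** Evaluating the cubic polynomial at [u + v] and [u + 2 v] separates the two mixed
terms [A u u v] and [A u v v]; evaluating [A u u w] at [u + v] then polarizes. *)
Lemma cubic_eq0 i x : chart_cod (atlas i) x -> (forall u, A i x u u u = 0) ->
  forall u v w, A i x u v w = 0.
Proof.
move=> xi H.
have D1 u u' v w : A i x (u + u') v w = A i x u v w + A i x u' v w.
  exact: (scalarD_fun _ _ (@cubic_scalar1 i x v w)).
have D2 u v v' w : A i x u (v + v') w = A i x u v w + A i x u v' w.
  exact: (scalarD_fun _ _ (@cubic_scalar2 i x u w)).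
have D3 u v w w' : A i x u v (w + w') = A i x u v w + A i x u v w'.
  exact: (scalarD_fun _ _ (@cubic_scalar3 i x u v)).
have Q u v : A i x u u v + A i x u v v = 0.
  have := H (u + v); rewrite !(D1, D2, D3) !H.
  rewrite (cubic_sym12 v u v)// (cubic_sym13 v u u)// (cubic_sym13 v v u)//.
  rewrite (cubic_sym23 u v u)//; lra.
have S u v : A i x u u v = 0.
  have := Q u (v + v); have := Q u v; rewrite !(D2, D3); lra.
move=> u v w; have := S (u + v) w; rewrite !(D1, D2) !S (cubic_sym12 v u)//; lra.
Qed.

Lemma is_derive_geodesic gamma i (t : R) : geodesic nabla setT gamma ->
  chart_dom (atlas i) (gamma t) ->
  let c := chart_fun (atlas i) \o gamma in
  [/\ chart_cod (atlas i) (c t), is_derive t 1 c (derive1 c t) &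
    is_derive t 1 (derive1 c) (- conn nabla i (c t) (derive1 c t) (derive1 c t))].
Proof.
move=> [_ _ _ _ H] ti c; have [cd dcd E] := H t i I ti.
have v1 : 'D_1 c t = derive1 c t by rewrite derive1E.
have v2 : 'D_1 (derive1 c) t = - conn nabla i (c t) (derive1 c t) (derive1 c t).
  by rewrite -derive1E; apply/eqP; rewrite -addr_eq0; apply/eqP.
split; first exact: chart_fun_cod.
  exact: DeriveDef cd v1.
exact: DeriveDef dcd v2.
Qed.

Lemma near_chart gamma i (t : R) : geodesic nabla setT gamma ->
  chart_dom (atlas i) (gamma t) -> \forall s \near t, chart_dom (atlas i) (gamma s).
Proof.
move=> [_ _ _ gc _] ti; apply: near_curve => //; last exact: gc.
exact: chart_dom_open.
Qed.

Definition speed2 gamma i (t : R) :=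
  let c := chart_fun (atlas i) \o gamma in inner g i (c t) (derive1 c t) (derive1 c t).

(** Near [t] the two local expressions of the curve differ by the transition map. *)
Lemma speed2_chart gamma i j (t : R) : geodesic nabla setT gamma ->
  chart_dom (atlas i) (gamma t) -> chart_dom (atlas j) (gamma t) ->
  speed2 gamma i t = speed2 gamma j t.
Proof.
move=> gg ti tj; have [ci cD _] := is_derive_geodesic gg ti.
pose tau := transition (atlas i) (atlas j).
pose c := chart_fun (atlas i) \o gamma.
have cij : overlap (atlas i) (atlas j) (c t) by split => //; rewrite /c/= chart_funK.
have cE : \forall s \near t, tau (c s) = (chart_fun (atlas j) \o gamma) s.
  by apply: filterS (near_chart gg ti) => s si; rewrite /tau /transition /c/= chart_funK.
have cjD := near_eq_is_derive cE (is_derive_transition cij cD).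
rewrite /speed2 /inner (metric_transition g _ _ cij) -(derive1_is_derive cjD).
by rewrite -(nbhs_singleton cE).
Qed.

(** The squared speed of the geodesic with initial velocity [u] has derivative
[- 2 A u u u] at time [0], which cannot be positive. *)
Lemma cubic_diag_ge0 : complete_connection nabla ->
  (forall i x u, chart_cod (atlas i) x -> inner g i x u u = 1 -> dA i x u u u u <= 0) ->
  forall i x u, chart_cod (atlas i) x -> 0 <= A i x u u u.
Proof.
move=> complete dA_le0 i x u xi.
have [gamma [gg g0 dg0]] := complete_geodesic_existence u complete xi.
have /choice[idx idxP] : forall t, exists j, chart_dom (atlas j) (gamma t).
  by move=> t; exact: atlas_cover.
pose c j := chart_fun (atlas j) \o gamma.
pose cub j t := A j (c j t) (derive1 (c j) t) (derive1 (c j) t) (derive1 (c j) t).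
pose k j t := K j (c j t) (derive1 (c j) t) (derive1 (c j) t).
pose dcub j t := dA j (c j t) (derive1 (c j) t) (derive1 (c j) t)
  (derive1 (c j) t) (derive1 (c j) t) - 3 * inner g j (c j t) (k j t) (k j t).
pose phi t := speed2 gamma (idx t) t.
(* one chart per time suffices to define the squared speed on the whole line *)
have phiE j t : chart_dom (atlas j) (gamma t) -> phi t = speed2 gamma j t.
  by move=> tj; apply: speed2_chart.
have phiD j (t : R) : chart_dom (atlas j) (gamma t) -> is_derive t 1 phi (- 2 * cub j t).
  move=> tj; have [cj cD wD] := is_derive_geodesic gg tj.
  apply: near_eq_is_derive (is_derive_speed cj cD wD).
  by apply: filterS (near_chart gg tj) => s sj; rewrite (phiE j).
pose phi' t := - 2 * cub (idx t) t.
have phi'E j t : chart_dom (atlas j) (gamma t) -> phi' t = - 2 * cub j t.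
  by move=> tj; rewrite /phi'; have [_ <-] := phiD _ _ tj; have [_ <-] := phiD _ _ (idxP t).
have phi'D (t : R) : is_derive t 1 phi' (- 2 * dcub (idx t) t).
  have tj := idxP t; have [cj cD wD] := is_derive_geodesic gg tj.
  have D := is_derive_cubic cj cD wD.
  have := is_derive_mul (is_derive_cst (- 2 : R) t (1 : R)) D; rewrite mul0r add0r => D'.
  apply: near_eq_is_derive D'.
  by apply: filterS (near_chart gg tj) => s sj; rewrite (phi'E (idx t)).
have x_dom : chart_dom (atlas i) (gamma 0) by rewrite g0; exact: chart_inv_dom.
have c0 : c i 0 = x by rewrite /c/= g0 chart_invK.
have -> : A i x u u u = - (phi' 0) / 2.
  by rewrite (phi'E i)// /cub c0 dg0; lra.
have dA0 t : dcub (idx t) t <= - 3 * inner g (idx t) (c (idx t) t) (k (idx t) t) (k (idx t) t).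
  have [cj _ _] := is_derive_geodesic gg (idxP t).
  have := nabla_cubic_le0 (derive1 (c (idx t)) t) cj (fun v => dA_le0 _ _ v cj).
  by rewrite /dcub -/(c _) -/(c _ _); lra.
suff : phi' 0 <= 0 by lra.
apply: (@convex_power_derive_le0 _ phi phi' (fun t => - 2 * dcub (idx t) t)) => // t.
- exact: phiD.
- have [cj _ _] := is_derive_geodesic gg (idxP t).
  exact: inner_ge0.
- have [cj _ _] := is_derive_geodesic gg (idxP t).
  by have := dA0 t; have := inner_ge0 (k (idx t) t) cj; rewrite -/(c _) -/(c _ _); lra.
- have [cj _ _] := is_derive_geodesic gg (idxP t).
  have CS := cauchy_schwarz_metric (k (idx t) t) (derive1 (c (idx t)) t) cj.
  have p0 : 0 <= phi t by exact: inner_ge0.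
  have := ler_wpM2l p0 (dA0 t).
  have : cub (idx t) t ^+ 2 <= inner g (idx t) (c (idx t) t) (k (idx t) t) (k (idx t) t) * phi t.
    exact: CS.
  by rewrite /phi' exprMn; lra.
Qed.

End CubicForm.

Theorem theorem4p1 (R : realType) (n : nat) (M : manifold R n)
    (g : metric M) (nabla nabla_hat : connection M) :
  statistical_structure g nabla ->
  levi_civita g nabla_hat ->
  complete_connection nabla ->
  (forall (i : chart_index M) (x u : 'rV[R]_n),
     chart_cod (atlas i) x -> inner g i x u u = 1 ->
     nabla_cubic_form g nabla nabla_hat i x u u u u <= 0) ->
  same_connection nabla nabla_hat.
Proof.
move=> stat lc complete dA_le0 i x u v xi.
have ge0 := cubic_diag_ge0 stat lc complete dA_le0.
have diag0 w : cubic_form g nabla nabla_hat i x w w w = 0.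
  have Z : cubic_form g nabla nabla_hat i x (- w) (- w) (- w) =
      - cubic_form g nabla nabla_hat i x w w w.
    rewrite (scalarN_fun _ (@cubic_scalar1 _ _ _ g nabla nabla_hat i x _ _)).
    rewrite (scalarN_fun _ (@cubic_scalar2 _ _ _ g nabla nabla_hat i x _ _)).
    by rewrite (scalarN_fun _ (@cubic_scalar3 _ _ _ g nabla nabla_hat i x _ _)) opprK.
  by apply/eqP; rewrite eq_le ge0// andbT -oppr_ge0 -Z ge0.
have K0 : difference_tensor nabla nabla_hat i x u v = 0.
  by apply: (@inner_eq0 _ _ _ g i x) => //; exact: cubic_eq0 diag0 _ _ _.
by apply/eqP; rewrite -subr_eq0 -/(difference_tensor nabla nabla_hat i x u v) K0.
Qed.
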